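(* Let $\mathcal H$ be a half-edged ribbon graph (HERG), let $e$ be one of its ribbon edges, and let $\mathcal R$ be the Bollobás–Riordan polynomial for HERGs defined in the context. (1) If $e$ is an ordinary edge, then $\mathcal R_{\mathcal H}=\mathcal R_{\mathcal H\vee e}+\mathcal R_{\mathcal H/e}$. (2) If $e$ is a bridge, then $\mathcal R_{\mathcal H}=(x-1)\,\mathcal R_{\mathcal H\vee e}+\mathcal R_{\mathcal H/e}$. (3) If $e$ is a trivial negative loop, then $\mathcal R_{\mathcal H}=\mathcal R_{\mathcal H\vee e}+(y-1)zw\,\mathcal R_{\mathcal H/e}$. (4) If $e$ is a trivial positive loop, then $\mathcal R_{\mathcal H}=\mathcal R_{\mathcal H\vee e}+(y-1)\,\mathcal R_{\mathcal H/e}$.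
   Context: **Ribbon graphs.** A ribbon graph is a (not necessarily orientable) surface with boundary represented as the union of two finite sets of closed topological discs, vertices and edges, such that vertices and edges intersect in disjoint line segments, each such segment lies on the boundary of precisely one vertex and one edge, and each edge contains exactly two such segments. An edge is ordinary if it is neither a bridge nor a loop. A loop $e$ at a vertex $v$ is positive if $e\cup v$ is an annulus, negative if $e\cup v$ is a Möbius band; it is trivial if there is no cycle in the graph which can be contracted to form a loop $f$ at $v$ such that the ends of $e$ and $f$ alternate in the cyclic order at $v$. **HERGs.** A ribbon half-edge (HR) is a rectangle incident to a unique vertex disc along one line segment $\sigma$ of its boundary (not forming a loop); the side parallel to $\sigma$ is its external segment, whose two end points are its external points. A HERG is a ribbon graph (its underlying ribbon graph) together with a finite set $\mathfrak f^0$ of HRs, each attached to a unique vertex, along segments disjoint from each other and from the segments where ribbon edges are attached. **Operations.** The cut $\mathcal H\vee e$ deletes $e$ and attaches two HRs at the two segments where $e$ was attached. Contraction $\mathcal H/e$: if $e$ is not a loop and has end vertices $v_1,v_2$, replace $e,v_1,v_2$ by the single vertex disc $e\cup v_1\cup v_2$. If $e$ is a trivial negative loop at $v$, delete $e$ and $v$ and add one new vertex whose boundary is the boundary of $e\cup v$. If $e$ is a trivial positive loop at $v$, delete $e$ and $v$ and add two new vertices, the union of whose boundaries is the boundary of $e\cup v$. All other edges and HRs keep their attachments and cyclic orders. A spanning c-subgraph $A\Subset\mathcal H$ is obtained by cutting all edges in some subset of the ribbon edges (all vertices and HRs are kept). **Faces and boundary graph.** A closed face is a boundary component which never passes through an external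 segment of a HR; an open face is a boundary arc leaving an external point of some HR and rejoining another external point without passing through any external segment. The boundary graph $\partial\mathcal H$ is the abstract graph with one vertex per HR and one edge per open face, joining the HRs that contain the end points of the open face (a loop if both are in the same HR). **Polynomial.** For a HERG with vertex set $\mathcal V$, edge set $\mathcal E$ and $k$ connected components, put $r=|\mathcal V|-k$ and $n=|\mathcal E|+k-|\mathcal V|$. Let $F_{\rm int}(A)$ be the number of closed faces of $A$, $C_\partial(A)$ the number of connected components of $\partial A$, $f(A)$ the number of HRs of $A$, and $o(A)=0$ if $A$ is orientable, $o(A)=1$ otherwise. Then, with the relation $w^2=w$, $$\mathcal R_{\mathcal H}(x,y,z,s,w,t)=\sum_{A\Subset \mathcal H}(x-1)^{r(\mathcal H)-r(A)}(y-1)^{n(A)}z^{k(A)-F_{\rm int}(A)+n(A)}s^{C_\partial(A)}w^{o(A)}t^{f(A)}.$$ *)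

(* Defs.v *)
From mathcomp Require Import all_boot all_algebra.
From mathcomp Require Import mpoly.

Set Implicit Arguments.
Unset Strict Implicit.
Unset Printing Implicit Defensive.

Import GRing.Theory.

(* Combinatorial encoding of half-edged ribbon graphs, up to homeomorphism.
   A flag is an end point of a segment along which a rectangle (a ribbon edge
   or a ribbon half-edge) is attached to a vertex disc. For a flag x,
   - seg x is the other end point of its segment;
   - arc x is the next flag met when leaving x along the boundary of the
     vertex disc, away from the segment;
   - rib x is the flag at the other end of the side of the rectangle which
     starts at x if this rectangle is a ribbon edge; if it is a ribbon
     half-edge, that side ends at an external point and rib x = x.
   A vertex disc to which nothing is attached has no flag: only the number
   isolated of these discs is recorded. *)
Record herg := Herg {
  flag : finType;
  seg : flag -> flag;
  arc : flag -> flag;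
  rib : flag -> flag;
  isolated : nat;
  segK : involutive seg;
  arcK : involutive arc;
  ribK : involutive rib;
  seg_neq : forall x, seg x != x;
  arc_neq : forall x, arc x != x;
  rib_neq_seg : forall x, rib x != seg x;
  rib_seg : forall x, rib (seg x) = seg (rib x) }.

Arguments seg {h} x.
Arguments arc {h} x.
Arguments rib {h} x.

Section Cells.
Variable H : herg.
Implicit Types x y : flag H.

Definition cell (fs : seq (flag H -> flag H)) x : {set flag H} :=
  [set y | connect (fun u v => v \in [seq f u | f <- fs]) x y].

Definition vertex x := cell [:: seg; arc] x.
Definition component x := cell [:: seg; arc; rib] x.
(* component of the boundary of the surface, cut at the external segments *)
Definition face x := cell [:: arc; rib] x.
(* ribbon edge or ribbon half-edge, as the set of its four or two flags *)
Definition ribbon x : {set flag H} := [set x; seg x; rib x; seg (rib x)].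

Definition edges : {set {set flag H}} := [set ribbon x | x : flag H & rib x != x].
Definition hrs : {set {set flag H}} := [set ribbon x | x : flag H & rib x == x].

Definition nb_vertices : nat := #|[set vertex x | x : flag H]| + isolated H.
Definition nb_components : nat := #|[set component x | x : flag H]| + isolated H.

Definition faces : {set {set flag H}} := [set face x | x : flag H].
Definition closed_faces : {set {set flag H}} :=
  [set f in faces | [forall x in f, rib x != x]].
Definition open_faces : {set {set flag H}} := faces :\: closed_faces.
(* the boundary of an isolated vertex is a closed face without flag *)
Definition nb_closed_faces : nat := #|closed_faces| + isolated H.

(* The boundary graph: its vertices are the ribbon half-edges, and an open
   face joins the half-edges to which its two end flags belong. *)
Definition boundary_adj : rel {set flag H} := fun a b =>
  [&& a \in hrs, b \in hrs
    & [exists f in open_faces, (a :&: f != set0) && (b :&: f != set0)]].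
Definition nb_boundary_components : nat := n_comp boundary_adj hrs.

(* The surface is orientable iff the vertex discs can be oriented coherently:
   c is the set of flags at which a segment starts for such an orientation. *)
Definition orientable : bool :=
  [exists c : {set flag H}, [forall x,
    [&& (seg x \in c) == (x \notin c),
        (arc x \in c) == (x \notin c)
      & (rib x != x) ==> ((rib x \in c) == (x \notin c))]]].

Definition rank : nat := nb_vertices - nb_components.
Definition nullity : nat := #|edges| + nb_components - nb_vertices.

Lemma ribbon_rib x : ribbon (rib x) = ribbon x.
Proof. by apply/setP=> y; rewrite !inE ribK -!orbA; do 4 case: (y == _). Qed.

Lemma ribbon_seg x : ribbon (seg x) = ribbon x.
Proof.
by apply/setP=> y; rewrite !inE rib_seg !segK -!orbA; do 4 case: (y == _).
Qed.

End Cells.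

Section Cut.
Variables (H : herg) (S : {set {set flag H}}).

(* Every edge in S is replaced by two half-edges at the same segments. *)
Definition cut_rib (x : flag H) := if ribbon x \in S then x else rib x.

Lemma cut_ribK : involutive cut_rib.
Proof.
by move=> x; rewrite /cut_rib; case Sx: (ribbon x \in S); rewrite ?ribbon_rib Sx ?ribK.
Qed.

Lemma cut_rib_neq_seg x : cut_rib x != seg x.
Proof.
by rewrite /cut_rib; case: ifP => _; [rewrite eq_sym seg_neq | apply: rib_neq_seg].
Qed.

Lemma cut_rib_seg x : cut_rib (seg x) = seg (cut_rib x).
Proof. by rewrite /cut_rib ribbon_seg; case: ifP => // _; apply: rib_seg. Qed.

Definition cut : herg :=
  @Herg (flag H) seg arc cut_rib (isolated H) (@segK H) (@arcK H) cut_ribK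
    (@seg_neq H) (@arc_neq H) cut_rib_neq_seg cut_rib_seg.

End Cut.

(* Contraction of the edges in S. They are deleted together with their end
   vertices, and a new vertex disc is glued along every boundary component of
   the union of these edges and vertices. For one edge e, this is the usual
   contraction: the boundary of e and its ends has one component, bounding a
   single new vertex, if e is not a loop (the new vertex is then the union of e
   and its two ends) or is a negative loop, and two if e is a positive loop. *)
Section Contract.
Variables (H : herg) (S : {set {set flag H}}).

Definition contract_flags : {set flag H} :=
  [set x | (ribbon x \in S) && (rib x != x)].
Local Notation D := contract_flags.

(* From x outside D, follow the boundary of the union of the edges in S and
   their ends (at most #|D| sides of edges) up to the next flag outside D. *)
Definition contract_arc (x : flag H) : flag H :=
  iter #|D| (fun y => if y \in D then arc (rib y) else y) (arc x).

Lemma contract_flags_rib x : (rib x \in D) = (x \in D).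
Proof. by rewrite !inE ribbon_rib ribK eq_sym. Qed.

Lemma contract_flags_seg x : (seg x \in D) = (x \in D).
Proof.
by rewrite !inE ribbon_seg rib_seg (inj_eq (can_inj (@segK H))).
Qed.

Let walk m (x : flag H) := iter m (fun y => arc (rib y)) (arc x).

Lemma walkK m : involutive (walk m).
Proof.
elim: m => [|m IHm] x; first exact: arcK.
have walkS y : walk m.+1 y = walk m (rib (arc y)) by rewrite /walk iterSr.
by rewrite walkS /walk iterS -/(walk _ _) arcK ribK IHm.
Qed.

Lemma walk_add i j x : walk (i + j) x = walk i (arc (walk j x)).
Proof. by rewrite /walk iterD arcK. Qed.

Lemma contract_arcP x : x \notin D -> exists m,
  [/\ contract_arc x = walk m x, walk m x \notin D
    & forall i, i < m -> walk i x \in D].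
Proof.
move=> xD; have [m0 m0D m0le]: exists2 m, walk m x \notin D & m <= #|D|.
  have [/existsP[i iD]|/existsPn allD] :=
    boolP [exists i : 'I_#|D|.+1, walk i x \notin D].
    by exists i => //; rewrite -ltnS.
  have inD (i : 'I_#|D|.+1) : walk i x \in D by have := allD i; rewrite negbK.
  have /injectivePn[i [j neq eqw]] :
      ~~ injectiveb (fun i : 'I_#|D|.+1 => walk i x).
    apply/negP=> /injectiveP inj;
    have /subset_leq_card : [set walk i x | i : 'I_#|D|.+1] \subset D.
      by apply/subsetP=> _ /imsetP[i _ ->].
    by rewrite card_imset // card_ord ltnn.
  have main (p q : nat) : p < q -> q <= #|D| -> walk p x = walk q x -> False.
    move=> pq qD; have -> : q = p + (q - p) by rewrite subnKC // ltnW.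
    rewrite walk_add => /(congr1 (walk p)); rewrite !walkK => /esym.
    have : 0 < q - p by rewrite subn_gt0.
    case: (q - p) (leq_subr p q) => // d dq _ /=; rewrite arcK => xE.
    have dD : d < #|D|.+1 by rewrite ltnS ltnW // (leq_trans dq).
    have := inD (Ordinal dD); rewrite -contract_flags_rib /= => ?.
    by move: xD; rewrite -xE => /negP; apply.
  exfalso; move: neq; rewrite -val_eqE neq_ltn => /orP[] lt.
    exact: (main i j lt (leq_ord j) eqw).
  exact: (main j i lt (leq_ord i) (esym eqw)).
have exm : exists m, walk m x \notin D by exists m0.
exists (ex_minn exm); case: ex_minnP => m mD minm.
have inD i : i < m -> walk i x \in D.
  by move=> im; apply/negPn/negP=> /minm; rewrite leqNgt im.
split=> //; rewrite /contract_arc.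
have stepE i : i <= m ->
    iter i (fun y => if y \in D then arc (rib y) else y) (arc x) = walk i x.
  by elim: i => // i IHi im; rewrite iterS IHi 1?ltnW // inD.
rewrite -(subnK (leq_trans (minm _ m0D) m0le)) iterD stepE //.
elim: (_ - _) => // d IHd; rewrite iterS IHd.
by rewrite (negbTE mD).
Qed.

Lemma contract_arc_notin x : x \notin D -> contract_arc x \notin D.
Proof. by case/contract_arcP=> m [-> ]. Qed.

Lemma contract_arcK x : x \notin D -> contract_arc (contract_arc x) = x.
Proof.
move=> xD; have [m [-> mD inD]] := contract_arcP xD.
have [m' [-> m'D inD']] := contract_arcP mD.
suff -> : m' = m by apply: walkK.
have back i : i < m -> walk i (walk m x) \in D.
  move=> im; have -> : m = i + (m - i.+1).+1 by rewrite -subSn // subSS subnKC // ltnW.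
  rewrite walk_add walkK /walk iterS arcK contract_flags_rib; apply: inD.
  by rewrite -subSn // subSS leq_subr.
apply/eqP; rewrite eqn_leq; apply/andP; split; rewrite leqNgt; apply/negP.
  by move/inD'; rewrite walkK (negbTE xD).
by move/back; rewrite (negbTE m'D).
Qed.

Lemma contract_arc_neq x : x \notin D -> contract_arc x != x.
Proof.
move=> xD; have [m [-> mD inD]] := contract_arcP xD; apply/eqP => wx.
have := odd_double_half m; case: (odd m) => /= mE; move: wx; last first.
  rewrite -mE add0n -addnn walk_add => /(congr1 (walk m./2)); rewrite walkK => /eqP.
  by rewrite (negbTE (arc_neq _)).
rewrite -mE add1n -addnn -addnS walk_add => /(congr1 (walk m./2)).
rewrite walkK /walk iterS arcK -/(walk _ _) => /eqP wE.
have : walk m./2 x \in D by apply: inD; rewrite -{2}mE add1n ltnS -addnn leq_addr.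
by rewrite inE wE andbF.
Qed.

Definition contract_flag : finType := {x : flag H | x \notin D}.

Definition of_contract_flag (x : contract_flag) : flag H := val x.

Lemma contract_seg_subproof (x : contract_flag) : seg (val x) \notin D.
Proof. by rewrite contract_flags_seg (valP x). Qed.

Lemma contract_rib_subproof (x : contract_flag) : rib (val x) \notin D.
Proof. by rewrite contract_flags_rib (valP x). Qed.

Definition contract_seg (x : contract_flag) : contract_flag :=
  Sub (seg (val x)) (contract_seg_subproof x).
Definition contract_rib (x : contract_flag) : contract_flag :=
  Sub (rib (val x)) (contract_rib_subproof x).
Definition contract_next (x : contract_flag) : contract_flag :=
  Sub (contract_arc (val x)) (contract_arc_notin (valP x)).

Lemma contract_segK : involutive contract_seg.
Proof. by move=> x; apply: val_inj; rewrite /= segK. Qed.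

Lemma contract_ribK : involutive contract_rib.
Proof. by move=> x; apply: val_inj; rewrite /= ribK. Qed.

Lemma contract_nextK : involutive contract_next.
Proof. by move=> x; apply: val_inj; apply: contract_arcK (valP x). Qed.

Lemma contract_seg_neq x : contract_seg x != x.
Proof. by rewrite -val_eqE seg_neq. Qed.

Lemma contract_next_neq x : contract_next x != x.
Proof. by rewrite -val_eqE contract_arc_neq ?(valP x). Qed.

Lemma contract_rib_neq_seg x : contract_rib x != contract_seg x.
Proof. by rewrite -val_eqE rib_neq_seg. Qed.

Lemma contract_rib_seg x :
  contract_rib (contract_seg x) = contract_seg (contract_rib x).
Proof. by apply: val_inj; rewrite /= rib_seg. Qed.

(* The boundary components to which nothing else is attached become isolated
   vertices; they are the faces all of whose flags are in D. *)
Definition contract : herg :=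
  @Herg contract_flag contract_seg contract_next contract_rib
    (isolated H + #|[set f in faces H | f \subset D]|)
    contract_segK contract_nextK contract_ribK contract_seg_neq
    contract_next_neq contract_rib_neq_seg contract_rib_seg.

End Contract.

Section Edges.
Variable H : herg.
Implicit Types e f : {set flag H}.

Definition loop e : bool := [forall x in e, rib x \in vertex x].

Definition bridge e : bool :=
  nb_components H < nb_components (cut [set e]).

Definition ordinary e : bool := ~~ bridge e && ~~ loop e.

(* Once all the other edges are cut, the surface consists of e together with
   its end v and of discs, so it is orientable iff the union of e and v is an
   annulus, and not orientable iff this union is a Moebius band. *)
Definition positive_loop e : bool :=
  loop e && orientable (cut (edges H :\ e)).
Definition negative_loop e : bool :=
  loop e && ~~ orientable (cut (edges H :\ e)).

(* turn around a vertex: arc (seg x) is the first flag of the segment after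
   that of x *)
Definition next_segment (x : flag H) : flag H := arc (seg x).

(* Around some vertex, one meets e, f, e, f in this order: e and f are then
   loops at this vertex. *)
Definition alternate e f : Prop :=
  exists x : flag H, exists i j k : nat,
    [/\ x \in e, 0 < i < j, j < k < order next_segment x,
        iter i next_segment x \in f
      & iter j next_segment x \in e /\ iter k next_segment x \in f].

(* A cycle of the underlying graph, as the sequence of the flags at which its
   successive edges are entered. *)
Definition graph_cycle (c : seq (flag H)) : bool :=
  [&& all (fun x => rib x != x) c,
      cycle (fun x y => y \in vertex (rib x)) c,
      uniq [seq vertex x | x <- c]
    & uniq [seq ribbon x | x <- c]].

End Edges.

(* The cycle x :: s is contracted to the loop (ribbon x) by contracting the
   edges of s. *)
Definition trivial_loop (H : herg) (e : {set flag H}) : Prop :=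
  loop e /\
  ~ exists (x : flag H) (s : seq (flag H)),
      graph_cycle (x :: s) /\
      let S := [set:: [seq ribbon y | y <- s]] in
      @alternate (contract S) [set y | of_contract_flag y \in e]
                              [set y | of_contract_flag y \in ribbon x].

Local Open Scope ring_scope.

Definition X_ : {mpoly int[6]} := 'X_(@inord 5 0).
Definition Y_ : {mpoly int[6]} := 'X_(@inord 5 1).
Definition Z_ : {mpoly int[6]} := 'X_(@inord 5 2).
Definition S_ : {mpoly int[6]} := 'X_(@inord 5 3).
Definition W_ : {mpoly int[6]} := 'X_(@inord 5 4).
Definition T_ : {mpoly int[6]} := 'X_(@inord 5 5).

(* equality in Z[x, y, z, s, w, t] / (w ^ 2 - w) *)
Definition eq_modW (P Q : {mpoly int[6]}) : Prop :=
  exists U : {mpoly int[6]}, P - Q = U * (W_ ^+ 2 - W_).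

Notation "P =w Q" := (eq_modW P Q) (at level 70, no associativity) : ring_scope.

(* The exponents are natural numbers and no subtraction is truncated: cutting
   edges does not increase the rank, and k + n - F_int is at least the Euler
   genus of the surface, as closed faces are boundary components. *)
Definition br_term (H A : herg) : {mpoly int[6]} :=
  (X_ - 1) ^+ (rank H - rank A)
  * (Y_ - 1) ^+ nullity A
  * Z_ ^+ (nb_components A + nullity A - nb_closed_faces A)
  * S_ ^+ nb_boundary_components A
  * W_ ^+ (~~ orientable A)
  * T_ ^+ #|hrs A|.

(* the spanning c-subgraphs of H are obtained by cutting sets S of edges *)
Definition br_poly (H : herg) : {mpoly int[6]} :=
  \sum_(S in powerset (edges H)) br_term H (cut S).

(* Main.v *)
(* Splitting the sum over the cut sets according to whether they contain e
   reduces the theorem to comparing, for each cut set S avoiding e, the terms of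
   A = cut S and of A / e. Let a, b be the ends of one segment of e and c, d the
   opposite corners. Every invariant counts classes of flags: the vertices of
   A / e are the classes of the relation obtained from that of the vertices of A
   by replacing the links a - b and c - d (along the segments) by the links
   a - c and b - d (along the sides), the components are treated in the same
   way, and the faces, the half-edges and the boundary graph do not change.
   The boundary arcs left by e on its end vertices join a, b, c, d in pairs, and
   adding a link merges at most two classes; the three pairings (no loop,
   untwisted loop, twisted loop) give the three relations between the terms.
   For a positive loop, triviality ensures that A / e has one more component
   than A: otherwise a path of A / e between the two new
   vertices closes up to a cycle of the graph, whose contraction yields a loop
   alternating with e. *)

Require Import Defs.
From mathcomp Require Import all_boot all_algebra.
From mathcomp Require Import mpoly zify ring.
Import Defs.

Set Implicit Arguments.
Unset Strict Implicit.
Unset Printing Implicit Defensive.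

Import GRing.Theory.

(** * Classes of a relation and additional links *)

(** Orientability is the one invariant that is not a count of classes. An orientation passes easily
    to a contraction; the converse is the difficulty, because an orientation of the contracted
    surface is silent about the flags of the lost edge. Extending it leaves a possible defect on the
    two segments of that edge: for a non-loop the boundary arcs exclude it, for a separating
    untwisted loop it is repaired by reversing one side. With a twisted loop [A] is never
    orientable, but [A / e] may or may not be; only when it is not does the comparison need w^2 = w.
    The exponents are truncated differences, so bounds of Euler type are required before terms can
    be compared. Triviality is phrased by contracting all edges of a cycle but one. The vertices are
    therefore followed while these edges are added one at a time to the contracted set, each being a
    non-loop when its turn comes. *)

Section Classes.
Variable T : finType.
Implicit Types (e : rel T) (u v x y : T).

Definition eqclass e x : {set T} := [set y | connect e x y].
Definition classes e : {set {set T}} := [set eqclass e x | x : T].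

Lemma sub_connect_eq e1 e2 :
  subrel e1 (connect e2) -> subrel e2 (connect e1) -> connect e1 =2 connect e2.
Proof.
by move=> s12 s21 x y; apply/idP/idP; apply: connect_sub.
Qed.

Lemma eq_classes e1 e2 : connect e1 =2 connect e2 -> classes e1 = classes e2.
Proof.
move=> E; apply: eq_imset => x; apply/setP=> y; by rewrite !inE E.
Qed.

Lemma eqclass_eq e x y : connect_sym e -> (eqclass e x == eqclass e y) = connect e x y.
Proof.
move=> sym; apply/eqP/idP => [/setP/(_ y)|xy]; first by rewrite !inE connect0.
by apply/setP=> z; rewrite !inE (same_connect sym xy).
Qed.

Lemma connect_invariant e (A : {pred T}) x y :
  (forall u v, u \in A -> e u v -> v \in A) -> x \in A -> connect e x y -> y \in A.
Proof.
move=> clA xA /connectP[p]; elim: p x xA => [|z p IHp] x xA /=; first by move=> _ ->.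
by case/andP=> /(clA _ _ xA) zA /(IHp z zA).
Qed.

Definition link e u v : rel T :=
  [rel x y | [|| e x y, (x == u) && (y == v) | (x == v) && (y == u)]].

Lemma link_symmetric e u v : ssrbool.symmetric e -> ssrbool.symmetric (link e u v).
Proof.
by move=> sym x y; rewrite /link /= sym orbC orbC; congr (_ || _); rewrite orbC; congr (_ || _); exact: andbC.
Qed.

(** A second use of the new link leads back to a class already reached, so the right-hand side,
    which allows one use in either direction, is closed under steps. *)
Lemma connect_link e u v x y : connect_sym e ->
  connect (link e u v) x y =
  [|| connect e x y, connect e x u && connect e v y | connect e x v && connect e u y].
Proof.
move=> sym; have sub : subrel (connect e) (connect (link e u v)).
  by apply: connect_sub => s t st; apply: connect1; rewrite /link /= st.
have luv : connect (link e u v) u v by apply: connect1; rewrite /link /= !eqxx orbT.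
have lvu : connect (link e u v) v u by apply: connect1; rewrite /link /= !eqxx !orbT.
apply/idP/idP; last first.
  case/or3P=> [/sub //|/andP[/sub xu /sub vy]|/andP[/sub xv /sub uy]].
    exact: connect_trans xu (connect_trans luv vy).
  exact: connect_trans xv (connect_trans lvu uy).
pose A : {pred T} := [pred y | [|| connect e x y, connect e x u && connect e v y | connect e x v && connect e u y]].
apply: (@connect_invariant _ A); last by rewrite inE connect0.
move=> s t; rewrite !inE => As /or3P[st|/andP[/eqP su /eqP tv]|/andP[/eqP sv /eqP tu]].
- by rewrite -!(same_connect_r sym (connect1 st)).
- by subst; case/or3P: As => [->|/andP[-> _]|/andP[-> _]]; rewrite ?connect0 ?orbT.
- by subst; case/or3P: As => [->|/andP[-> _]|/andP[-> _]]; rewrite ?connect0 ?orbT.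
Qed.

Lemma connect_link_id e u v : connect_sym e -> connect e u v ->
  connect (link e u v) =2 connect e.
Proof.
move=> sym uv x y; rewrite connect_link //; apply/or3P/idP=> [|xy]; last by constructor.
case=> // /andP[xu vy]; first exact: connect_trans xu (connect_trans uv vy).
by apply: connect_trans xu (connect_trans _ vy); rewrite sym.
Qed.

Lemma connect_link_l e u v : connect (link e u v) u v.
Proof. by apply: connect1; rewrite /link /= !eqxx orbT. Qed.

Lemma sub_link e u v : subrel (connect e) (connect (link e u v)).
Proof. by apply: connect_sub => s t st; apply: connect1; rewrite /link /= st. Qed.

(** If the link joins two classes, every new class has a representative outside the old class of
    [v], since [h] moves that class to [u]; between points outside it the link creates no
    connection. So the old classes other than that of [v] are in bijection with the new ones. *)
Lemma card_classes_link e u v : ssrbool.symmetric e ->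
  #|classes e| = #|classes (link e u v)| + ~~ connect e u v.
Proof.
move=> esym; have sym := sym_connect_sym esym; have [uv|nuv] := boolP (connect e u v).
  by rewrite addn0 (eq_classes (connect_link_id sym uv)).
have syml := sym_connect_sym (link_symmetric u v esym).
rewrite addn1; pose U := eqclass e u; pose V := eqclass e v.
have Vin : V \in classes e by apply: imset_f.
rewrite (cardsD1 V) Vin add1n; congr _.+1.
pose h x := if connect e x v then u else x.
have cls_h x : eqclass (link e u v) (h x) = eqclass (link e u v) x.
  apply/eqP; rewrite eqclass_eq // /h; case: ifP => [xv|_]; last exact: connect0.
  by rewrite syml connect_link // xv connect0 !orbT.
have cls_inj x y : ~~ connect e x v -> ~~ connect e y v ->
    connect (link e u v) x y = connect e x y.
  move=> /negbTE nx /negbTE ny; rewrite connect_link // nx (sym v) ny andbF.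
  by rewrite orbF.
have hv x : ~~ connect e (h x) v by rewrite /h; case: ifP => [//|->].
pose f (C : {set T}) := if [pick z in C] is Some z then eqclass (link e u v) z else set0.
have fE x : f (eqclass e x) = eqclass (link e u v) x.
  rewrite /f; case: pickP => [y|/(_ x)/=]; last by rewrite inE connect0.
  by rewrite inE => xy; apply/eqP; rewrite eqclass_eq // syml sub_link.
have inj : {in classes e :\ V &, injective f}.
  move=> X Y /setD1P[XV /imsetP[x _ EX]] /setD1P[YV /imsetP[y _ EY]].
  move: XV YV; rewrite EX EY !eqclass_eq // !fE => nx ny /eqP; rewrite eqclass_eq // cls_inj // => xy.
  by apply/eqP; rewrite eqclass_eq.
rewrite -(card_in_imset inj); congr #|pred_of_set _|; apply/setP=> C.
apply/imsetP/imsetP => [[K /setD1P[_ /imsetP[x _ ->]] ->]|[x _ ->]].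
  by exists x => //; rewrite fE.
exists (eqclass e (h x)); last by rewrite fE cls_h.
by rewrite in_setD1 eqclass_eq // hv imset_f.
Qed.

Lemma eq_connect_link e e' u v : connect_sym e -> connect_sym e' ->
  connect e =2 connect e' -> connect (link e u v) =2 connect (link e' u v).
Proof. by move=> sy sy' E x y; rewrite !connect_link // !E. Qed.

Lemma card_classes_linkT e u v : ssrbool.symmetric e -> connect e u v ->
  #|classes (link e u v)| = #|classes e|.
Proof. by move=> sy uv; rewrite (card_classes_link u v sy) uv addn0. Qed.

Lemma card_classes_linkF e u v : ssrbool.symmetric e -> ~~ connect e u v ->
  #|classes e| = #|classes (link e u v)|.+1.
Proof. by move=> sy uv; rewrite (card_classes_link u v sy) uv addn1. Qed.

Lemma card_classes_sub e1 e2 : connect_sym e1 -> connect_sym e2 ->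
  subrel (connect e1) (connect e2) -> #|classes e2| <= #|classes e1|.
Proof.
move=> s1 s2 sub.
pose f (C : {set T}) := if [pick z in C] is Some z then eqclass e2 z else set0.
have fE x : f (eqclass e1 x) = eqclass e2 x.
  rewrite /f; case: pickP => [y|/(_ x)/=]; last by rewrite inE connect0.
  by rewrite inE => xy; apply/eqP; rewrite eqclass_eq // s2 sub.
have -> : classes e2 = f @: classes e1.
  by rewrite /classes -imset_comp; apply: eq_imset => x /=; rewrite fE.
exact: leq_imset_card.
Qed.

End Classes.

(** * Pairs of involutions *)

Section Step.
Variable T : finType.
Implicit Types (f g h : T -> T) (x y : T).

Definition step (fs : seq (T -> T)) : rel T := fun u v => v \in [seq f u | f <- fs].

Lemma step2E f g x y : step [:: f; g] x y = (y == f x) || (y == g x).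
Proof. by rewrite /step !inE. Qed.

Lemma step3E f g h x y : step [:: f; g; h] x y = [|| y == f x, y == g x | y == h x].
Proof. by rewrite /step !inE. Qed.

Lemma eq_inv f x y : involutive f -> (y == f x) = (x == f y).
Proof. by move=> fK; apply/eqP/eqP=> ->; rewrite fK. Qed.

Lemma step2_sym f g : involutive f -> involutive g -> ssrbool.symmetric (step [:: f; g]).
Proof. by move=> fK gK x y; rewrite !step2E !(eq_inv y x). Qed.

Lemma step3_sym f g h : involutive f -> involutive g -> involutive h ->
  ssrbool.symmetric (step [:: f; g; h]).
Proof. by move=> fK gK hK x y; rewrite !step3E !(eq_inv y x). Qed.

Definition walk f g m x := iter m (fun y => f (g y)) (f x).

Definition walk_set f g m x : {set T} :=
  [set y | (y == x) || (y == walk f g m x) ||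
           [exists i : 'I_m, (y == walk f g i x) || (y == g (walk f g i x))]].

(** A path whose two ends are fixed by [g] cannot be left: inside it [f] and [g] move to neighbours,
    and at the ends [g] does nothing. Hence it fills the class of [x]. *)
Lemma walk_setP f g m x y : involutive f -> involutive g ->
    g x = x -> g (walk f g m x) = walk f g m x -> connect (step [:: f; g]) x y ->
  [\/ y = x, y = walk f g m x |
      exists2 i, i < m & (y == walk f g i x) || (y == g (walk f g i x))].
Proof.
move=> fK gK gx gm xy; suff: y \in walk_set f g m x.
  rewrite inE -orbA => /or3P[/eqP|/eqP|/existsP[[i im]/= yi]]; first by constructor 1.
    by constructor 2.
  by constructor 3; exists i.
have inW i : i <= m -> walk f g i x \in walk_set f g m x.
  rewrite inE leq_eqVlt => /predU1P[->|im]; first by rewrite eqxx orbT.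
  by apply/orP; right; apply/existsP; exists (Ordinal im); rewrite eqxx.
have inG i : i < m -> g (walk f g i x) \in walk_set f g m x.
  by move=> im; rewrite inE; apply/orP; right; apply/existsP; exists (Ordinal im); rewrite eqxx orbT.
have inx : x \in walk_set f g m x by rewrite inE eqxx.
have fW i : i <= m -> f (walk f g i x) \in walk_set f g m x.
  by case: i => [|i] im; rewrite /walk /= ?fK // inG.
apply: (connect_invariant (A := mem (walk_set f g m x)) _ inx xy) => u v uW; rewrite step2E; move: uW.
rewrite [u \in _]inE -orbA => /or3P[/eqP->|/eqP->|/existsP[[i /= im]]].
- by rewrite gx => /orP[]/eqP->; [apply: (inW 0)|].
- by rewrite gm => /orP[]/eqP->; [apply: fW|apply: inW].
- case/orP=> /eqP-> /orP[]/eqP->; rewrite ?gK; first by apply/fW/ltnW.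
  + exact: inG.
  + exact: (inW i.+1).
  + by apply/inW/ltnW.
Qed.

End Step.

Section Doubled.
Variables (T : finType) (f g : T -> T).
Hypotheses (fK : involutive f) (gK : involutive g) (f_neq : forall x, f x != x).

Let dseg (p : T * bool) := (p.1, ~~ p.2).
Let darc (p : T * bool) := (f p.1, p.2).
Let drib (p : T * bool) := (g p.1, p.2).

Lemma dsegK : involutive dseg. Proof. by case=> x b; rewrite /dseg /= negbK. Qed.
Lemma darcK : involutive darc. Proof. by case=> x b; rewrite /darc /= fK. Qed.
Lemma dribK : involutive drib. Proof. by case=> x b; rewrite /drib /= gK. Qed.
Lemma dseg_neq p : dseg p != p.
Proof. by case: p => x b; rewrite xpair_eqE /= eqxx; case: b. Qed.
Lemma darc_neq p : darc p != p.
Proof. by case: p => x b; rewrite xpair_eqE /= negb_and f_neq. Qed.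
Lemma drib_neq_seg p : drib p != dseg p.
Proof. by case: p => x b; rewrite xpair_eqE /= negb_and; case: b; rewrite orbT. Qed.
Lemma drib_seg p : drib (dseg p) = dseg (drib p). Proof. by []. Qed.

(* Two copies of T joined by seg: any pair of involutions becomes the pair
   (arc, rib) of a herg, to which contract_arcP applies. *)
Definition doubled : herg :=
  @Herg (T * bool)%type dseg darc drib 0 dsegK darcK dribK dseg_neq darc_neq
    drib_neq_seg drib_seg.

(** In the doubled herg, the flags to be contracted are those moved by [g]. Then [contract_arcP]
    says that the walk stops, and [contract_arc_neq] that it does not stop where it began. *)
Lemma walk_end x : g x = x -> exists m,
  [/\ walk f g m x != x, g (walk f g m x) = walk f g m x
    & forall i, i < m -> g (walk f g i x) != walk f g i x].
Proof.
move=> gx; pose S := edges doubled; pose D := @contract_flags doubled S.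
have DE (p : flag doubled) : (p \in D) = (g p.1 != p.1).
  have E : (rib p == p) = (g p.1 == p.1).
    by case: p => y b; apply/eqP/eqP => [[]//|/= E]; rewrite /rib /= /drib /= E.
  rewrite inE E.
  case: (boolP (g p.1 == p.1)) => gp; rewrite ?andbF // andbT.
  by apply/imsetP; exists p => //; rewrite inE E.
have xD : ((x, true) : flag doubled) \notin D by rewrite DE gx eqxx.
have [m] := @contract_arcP doubled S _ xD.
have wE i : iter i (fun y => @arc doubled (rib y)) (@arc doubled (x, true)) = (walk f g i x, true).
  by elim: i => //= i ->.
rewrite wE DE /= negbK => -[cE /eqP wm wi].
have := @contract_arc_neq doubled S _ xD; rewrite cE => neq.
exists m; split=> // [|i im]; last by have := wi i im; rewrite wE DE.
by apply: contraNneq neq => /= ->.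
Qed.

End Doubled.

Section Ends.
Variables (T : finType) (f g : T -> T).
Hypotheses (fK : involutive f) (gK : involutive g) (f_neq : forall x, f x != x).
Local Notation R := (connect (step [:: f; g])).

Let sym : connect_sym (step [:: f; g]) := sym_connect_sym (step2_sym fK gK).

Lemma walk_connect m x : R x (walk f g m x).
Proof.
elim: m => [|m IHm]; first by apply: connect1; rewrite step2E eqxx.
apply: connect_trans IHm _.
apply: (connect_trans (y := g (walk f g m x))); apply: connect1; rewrite step2E eqxx ?orbT //.
Qed.

Lemma walk_fixed_unique m x y :
  g x = x -> g (walk f g m x) = walk f g m x ->
  (forall i, i < m -> g (walk f g i x) != walk f g i x) ->
  R x y -> g y = y -> y != x -> y = walk f g m x.
Proof.
move=> gx gm gi xy gy yx; case: (walk_setP fK gK gx gm xy) => // [E|[i im]].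
  by rewrite E eqxx in yx.
by case/orP=> /eqP E; move: (gi i im); [rewrite -E gy eqxx | rewrite -{2}[walk f g i x]gK -E gy E eqxx].
Qed.

(** A class of two involutions is a path or a cycle. With a fixed point of [g] it is a path, and
    since [f] has no fixed point, the fixed points of [g] in it are exactly its two ends. *)
Lemma ends_unique x y z : g x = x -> g y = y -> g z = z ->
  R x y -> R x z -> y != x -> z != x -> y = z.
Proof.
move=> gx gy gz xy xz yx zx; have [m [mx gm gi]] := walk_end fK gK f_neq gx.
by rewrite (walk_fixed_unique gx gm gi xy) // (walk_fixed_unique gx gm gi xz).
Qed.

Lemma ends_exists x : g x = x -> exists y, [/\ y != x, g y = y & R x y].
Proof.
move=> gx; have [m [mx gm gi]] := walk_end fK gK f_neq gx.
by exists (walk f g m x); split=> //; apply: walk_connect.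
Qed.

(** The walk between the two ends uses [f] once more than [g], so the colour changes an odd number
    of times. *)
Lemma ends_flip (c : pred T) x y :
  (forall u, c (f u) = ~~ c u) -> (forall u, g u != u -> c (g u) = ~~ c u) ->
  g x = x -> g y = y -> R x y -> y != x -> c y = ~~ c x.
Proof.
move=> cf cg gx gy xy yx; have [m [mx gm gi]] := walk_end fK gK f_neq gx.
rewrite (walk_fixed_unique gx gm gi xy) //.
have: forall i, i <= m -> c (walk f g i x) = ~~ c x.
  elim=> [|i IHi] im; first exact: cf.
  by rewrite /walk /= cf cg ?negbK ?IHi 1?ltnW // gi.
exact.
Qed.

End Ends.

Section TwoColouring.
Variables (T : finType) (f g : T -> T).
Hypotheses (fK : involutive f) (gK : involutive g).
Hypotheses (f_neq : forall x, f x != x) (g_neq : forall x, g x != x).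

(** Without fixed points every class is an even cycle, made of two orbits of [h] which [g]
    exchanges. The colour tells whether a point lies in the orbit of the chosen root of its
    class. *)
Lemma two_colouring : exists c : pred T,
  (forall x, c (f x) = ~~ c x) /\ (forall x, c (g x) = ~~ c x).
Proof.
pose h x := f (g x).
have h_inj : injective h by exact: inj_comp (can_inj fK) (can_inj gK).
have hg x : h (g (h x)) = g x by rewrite /h gK fK.
have symh := @fconnect_sym _ h h_inj.
(* Since [g x = h (g (h x))], a way of [n] steps from [x] to [g x] contains one of [n - 2] steps
   from [h x] to [g (h x)]. Descending by two ends at a fixed point of [g] or of [f]. *)
have itg n x : iter n h x != g x.
  have [k] := ubnP n; elim: k => // k IHk in n x *; case: n => [|[|n]] nk.
  - by rewrite /= eq_sym g_neq.
  - by rewrite /= /h f_neq.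
  rewrite iterSr iterS; apply/eqP=> E; rewrite -hg in E; move: (h_inj _ _ E) => /eqP.
  by apply/negP/IHk; lia.
have sepg x : ~~ fconnect h x (g x).
  by apply/negP=> /iter_findex E; move: (itg (findex h x (g x)) x); rewrite E eqxx.
have hgg x y : fconnect h x y -> fconnect h (g x) (g y).
  move=> /iter_findex <-; elim: (findex h x y) => [|n IHn] /=; first exact: connect0.
  by apply: connect_trans IHn _; rewrite symh; have := fconnect1 h (g (h (iter n h x))); rewrite hg.
have sym := sym_connect_sym (step2_sym fK gK).
pose r := fingraph.root (step [:: f; g]).
pose c : pred T := fun x => fconnect h (r x) x.
have cov x : c x || fconnect h (g (r x)) x.
  have : connect (step [:: f; g]) (r x) x by rewrite sym connect_root.
  pose A : {pred T} := [pred y | fconnect h (r x) y || fconnect h (g (r x)) y].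
  apply: (@connect_invariant _ _ A); last by rewrite inE connect0.
  have gA u : u \in A -> g u \in A.
    by rewrite !inE => /orP[] /hgg; rewrite ?gK => ->; rewrite ?orbT.
  have hA u : u \in A -> h u \in A.
    by rewrite !inE => /orP[] xu; rewrite (connect_trans xu (fconnect1 h u)) ?orbT.
  move=> u v uA; rewrite step2E => /orP[]/eqP->; last exact: gA.
  by have := hA _ (gA _ uA); rewrite /h gK.
have rg x : r (g x) = r x.
  by apply/eqP; rewrite fingraph.root_connect // sym connect1 // step2E eqxx orbT.
have cg x : c (g x) = ~~ c x.
  rewrite /c rg; apply/idP/idP => [rgx|].
    apply/negP=> rx; move: (sepg x); rewrite -(same_connect symh rx) //.
    by rewrite rgx.
  by move: (cov x); rewrite /c => /orP[-> //|/hgg]; rewrite gK.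
exists c; split=> // x.
have -> : f x = h (g x) by rewrite /h gK.
rewrite -cg /c; have -> : r (h (g x)) = r (g x).
  apply/eqP; rewrite fingraph.root_connect // sym; apply: (connect_trans (y := x)).
    by apply: connect1; rewrite step2E gK eqxx orbT.
  by apply: connect1; rewrite step2E /h gK eqxx.
by apply/idP/idP => rx; apply: connect_trans rx _; rewrite ?fconnect1 // symh fconnect1.
Qed.

End TwoColouring.

(** * The corners of an edge *)

Section Mix.
Variables (T : finType) (D : {set T}).
Implicit Types g r : T -> T.

(** With [r := id] the links of [g] inside [D] are removed; with [r := rib] they are replaced by the
    sides of the edges, which is the effect of contraction on the segments. *)
Definition mix r g x := if x \in D then r x else g x.

Lemma mixK r g : involutive r -> involutive g ->
  (forall x, (r x \in D) = (x \in D)) -> (forall x, (g x \in D) = (x \in D)) ->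
  involutive (mix r g).
Proof.
by move=> rK gK rD gD x; rewrite /mix; case xD: (x \in D); rewrite ?rD ?gD xD ?rK ?gK.
Qed.

End Mix.

(* The four corners of a ribbon edge: a - b and c - d are its segments (along
   g), a - c and b - d its sides (along r); contracting it exchanges their
   roles. *)
Section Rectangle.
Variables (T : finType) (f g r : T -> T) (a b c d : T).
Hypotheses (fK : involutive f) (gK : involutive g) (rK : involutive r).
Hypotheses (f_neq : forall x, f x != x) (g_neq : forall x, g x != x).
Hypotheses (ga : g a = b) (gc : g c = d) (ra : r a = c) (rb : r b = d).
Hypothesis abcd : uniq [:: a; b; c; d].

Let D : {set T} := [set a; b; c; d].
Local Notation offg := (mix D id g).
Local Notation offr := (mix D id r).

Let gb : g b = a. Proof. by rewrite -ga gK. Qed.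
Let gd : g d = c. Proof. by rewrite -gc gK. Qed.
Let rc : r c = a. Proof. by rewrite -ra rK. Qed.
Let rd : r d = b. Proof. by rewrite -rb rK. Qed.

Lemma rectangle_g x : (g x \in D) = (x \in D).
Proof.
have E y : (g x == y) = (x == g y) by rewrite eq_sym eq_inv.
by rewrite !inE !E ga gb gc gd -!orbA; do 4 case: (x == _).
Qed.

Lemma rectangle_r x : (r x \in D) = (x \in D).
Proof.
have E y : (r x == y) = (x == r y) by rewrite eq_sym eq_inv.
by rewrite !inE !E ra rb rc rd -!orbA; do 4 case: (x == _).
Qed.

Let ogK : involutive offg. Proof. by apply: mixK => // x; apply: rectangle_g. Qed.
Let orK : involutive offr. Proof. by apply: mixK => // x; apply: rectangle_r. Qed.

Local Notation B := (step [:: offg; f]).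
Local Notation C := (step [:: offg; f; offr]).
Local Notation R := (connect B).

Let symB : ssrbool.symmetric B := step2_sym ogK fK.
Let symC : ssrbool.symmetric C := step3_sym ogK fK orK.
Let csB : connect_sym B := sym_connect_sym symB.
Let csC : connect_sym C := sym_connect_sym symC.

Lemma og_fix x : (offg x == x) = (x \in D).
Proof. by rewrite /mix; case: ifP => _; [rewrite eqxx | apply/negbTE/g_neq]. Qed.

(* The vertex discs cut at the segments of D leave two boundary arcs, which
   join the four ends of these segments in pairs. The three cases are: D is not
   a loop, is an untwisted loop, is a twisted loop. *)
Lemma rectangle_pairing :
  [\/ [/\ R a b, R c d & ~~ R a c], [/\ R a c, R b d & ~~ R a b]
    | [/\ R a d, R b c, ~~ R a b & ~~ R a c]].
Proof.
have fixD x : x \in D -> offg x = x by rewrite -og_fix => /eqP.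
have [aD bD cD dD] : [/\ a \in D, b \in D, c \in D & d \in D] by rewrite !inE !eqxx !orbT.
move: abcd; rewrite /= !inE !negb_or andbT => /and3P[/and3P[nab nac nad] /andP[nbc nbd] ncd].
have stepC : R =2 connect (step [:: f; offg]).
  by move=> x y; apply: eq_connect => u v; rewrite !step2E orbC.
have un x y z (xD : x \in D) (yD : y \in D) (zD : z \in D) :
    R x y -> R x z -> y != x -> z != x -> y = z.
  by rewrite !stepC; apply: (ends_unique fK ogK f_neq); apply: fixD.
have ex x : x \in D -> exists y, [/\ y != x, y \in D & R x y].
  move=> xD; have [y [yx /eqP]] := ends_exists fK ogK f_neq (fixD _ xD).
  by rewrite -stepC og_fix => yD xy; exists y.
have no x y z : x \in D -> y \in D -> z \in D -> y != x -> z != x -> y != z -> R x y -> ~~ R x z.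
  by move=> xD yD zD yx zx yz xy; apply: contra yz => xz; apply/eqP/(un x).
have [p [pa pD Rap]] := ex a aD.
have [q [qb qD Rbq]] := ex b bD.
have [s [sc sD Rcs]] := ex c cD.
move: pD Rap pa; rewrite !inE -!orbA => /or4P[]/eqP->; first by rewrite eqxx.
- move=> ab _; constructor 1; split=> //; last by apply: (no a b c); rewrite // 1?eq_sym.
  move: sD Rcs sc; rewrite !inE -!orbA => /or4P[]/eqP-> // cs.
  + by rewrite csB (negbTE (no a b c _ _ _ _ _ _ ab)) // 1?eq_sym in cs.
  + rewrite csB in cs; rewrite csB in ab.
    by rewrite (negbTE (no b a c _ _ _ _ _ _ ab)) // 1?eq_sym in cs.
  + by rewrite eqxx.
- move=> ac _; constructor 2; split=> //; last by apply: (no a c b); rewrite // 1?eq_sym.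
  move: qD Rbq qb; rewrite !inE -!orbA => /or4P[]/eqP-> // bq.
  + by rewrite csB (negbTE (no a c b _ _ _ _ _ _ ac)) // 1?eq_sym in bq.
  + by rewrite eqxx.
  + rewrite csB in bq; rewrite csB in ac.
    by rewrite (negbTE (no c a b _ _ _ _ _ _ ac)) // 1?eq_sym in bq.
- move=> ad _; constructor 3; split=> //; try by [apply: (no a d b); rewrite // 1?eq_sym|apply: (no a d c); rewrite // 1?eq_sym].
  move: qD Rbq qb; rewrite !inE -!orbA => /or4P[]/eqP-> // bq.
  + by rewrite csB (negbTE (no a d b _ _ _ _ _ _ ad)) // 1?eq_sym in bq.
  + by rewrite eqxx.
  + rewrite csB in bq; rewrite csB in ad.
    by rewrite (negbTE (no d a b _ _ _ _ _ _ ad)) // 1?eq_sym in bq.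
Qed.

Lemma connect_mix (fs : seq (T -> T)) (h : T -> T) u v u' v' :
  ssrbool.symmetric (step (offg :: fs)) ->
  involutive h -> D =i [:: u; v; u'; v'] -> h u = v -> h u' = v' ->
  connect (step (mix D h g :: fs)) =2 connect (link (link (step (offg :: fs)) u v) u' v').
Proof.
set e := step _ => syme hK DE hu hu'; apply: sub_connect_eq => x y.
  rewrite /step /= inE => /predU1P[->|yfs]; last first.
    by apply/sub_link/sub_link/connect1; rewrite /e /step /= inE yfs orbT.
  rewrite /mix; case: ifP => xD; last first.
    by apply/sub_link/sub_link/connect1; rewrite /e /step /= inE /mix xD eqxx.
  have l1 := sub_link u' v' (connect_link_l e u v).
  have l2 := connect_link_l (link e u v) u' v'.
  have sy := sym_connect_sym (link_symmetric u' v' (link_symmetric u v syme)).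
  have hv : h v = u by rewrite -hu hK.
  have hv' : h v' = u' by rewrite -hu' hK.
  move: xD; rewrite DE !inE => /or4P[]/eqP->; rewrite ?hu ?hu' ?hv ?hv' //;
    by rewrite sy.
have in4 z : z \in [:: u; v; u'; v'] -> mix D h g z = h z by rewrite -DE /mix => ->.
rewrite /link /= => /orP[/orP[|/orP[]/andP[/eqP-> /eqP->]]|/orP[]/andP[/eqP-> /eqP->]].
- rewrite /e /step /= inE => /predU1P[->|yfs]; last first.
    by apply: connect1; rewrite /step /= inE yfs orbT.
  rewrite /mix; case: ifP => xD; first exact: connect0.
  by apply: connect1; rewrite /step /= inE /mix xD eqxx.
- by apply: connect1; rewrite /step /= inE in4 ?hu ?eqxx // !inE eqxx.
- by apply: connect1; rewrite /step /= inE in4 -?hu ?hK ?eqxx // !inE eqxx ?orbT.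
- by apply: connect1; rewrite /step /= inE in4 ?hu' ?eqxx // !inE eqxx ?orbT.
- by apply: connect1; rewrite /step /= inE in4 -?hu' ?hK ?eqxx // !inE eqxx ?orbT.
Qed.

Let D_g : D =i [:: a; b; c; d].
Proof. by move=> x; rewrite !inE -!orbA. Qed.

Let D_r : D =i [:: a; c; b; d].
Proof. by move=> x; rewrite !inE -!orbA; congr (_ || _); rewrite orbCA. Qed.

Lemma mix_id x : mix D g g x = g x. Proof. by rewrite /mix if_same. Qed.

Lemma eq_step (fs fs' : seq (T -> T)) :
  (forall x, [seq h x | h <- fs] = [seq h x | h <- fs']) -> step fs =2 step fs'.
Proof. by move=> E x y; rewrite /step E. Qed.

Lemma connect_g fs : ssrbool.symmetric (step (offg :: fs)) ->
  connect (step (g :: fs)) =2 connect (link (link (step (offg :: fs)) a b) c d).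
Proof.
move=> sy x y; rewrite -(connect_mix sy gK D_g ga gc).
by apply: eq_connect; apply: eq_step => z /=; rewrite mix_id.
Qed.

Lemma connect_swap fs : ssrbool.symmetric (step (offg :: fs)) ->
  connect (step (mix D r g :: fs)) =2 connect (link (link (step (offg :: fs)) a c) b d).
Proof. by move=> sy; apply: (connect_mix sy rK D_r ra rb). Qed.

Lemma connect_swap_r :
  connect (step [:: mix D r g; f; r]) =2 connect (step [:: mix D r g; f; offr]).
Proof.
apply: sub_connect_eq => x y; rewrite !step3E => /or3P[]/eqP->.
- by apply: connect1; rewrite step3E eqxx.
- by apply: connect1; rewrite step3E eqxx orbT.
- by apply: connect1; rewrite step3E /mix; case: ifP; rewrite eqxx ?orbT.
- by apply: connect1; rewrite step3E eqxx.
- by apply: connect1; rewrite step3E eqxx orbT.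
- by rewrite /mix; case: ifP => _; [apply: connect0 | apply: connect1; rewrite step3E eqxx !orbT].
Qed.

(** The sides add the links a - c and b - d, but the second follows from the first and the two
    segments. *)
Lemma connect_g_r :
  connect (step [:: g; f; r]) =2 connect (link (step [:: g; f; offr]) a c).
Proof.
set e := step [:: g; f; offr].
have syme : ssrbool.symmetric e := step3_sym gK fK orK.
have sy := sym_connect_sym (link_symmetric a c syme).
have ge x : connect (link e a c) x (g x) by apply/sub_link/connect1; rewrite /e step3E eqxx.
have lac := connect_link_l e a c.
have lbd : connect (link e a c) b d.
  by rewrite -ga -gc; apply: connect_trans (ge c); apply: connect_trans lac; rewrite sy ge.
apply: sub_connect_eq => x y.
  rewrite step3E => /or3P[]/eqP->; first exact: ge.
    by apply/sub_link/connect1; rewrite /e step3E eqxx orbT.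
  have [|xD] := boolP (x \in D).
    rewrite !inE -!orbA => /or4P[]/eqP->; rewrite ?ra ?rb ?rc ?rd //; by rewrite sy.
  by apply/sub_link/connect1; rewrite /e step3E /mix (negbTE xD) eqxx !orbT.
rewrite /link /= /e step3E => /orP[/or3P[]/eqP->|].
- by apply: connect1; rewrite step3E eqxx.
- by apply: connect1; rewrite step3E eqxx orbT.
- by rewrite /mix; case: ifP => _; [apply: connect0 | apply: connect1; rewrite step3E eqxx !orbT].
- by case/orP=> /andP[/eqP-> /eqP->]; apply: connect1; rewrite step3E ?ra ?rc eqxx !orbT.
Qed.

Local Notation nc fs := #|classes (step fs)|.

Lemma sub_BC : subrel R (connect C).
Proof.
apply: connect_sub => x y; rewrite step2E => xy; apply: connect1.
by rewrite step3E orbA xy.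
Qed.

(** Both vertex counts come from [B] by adding two links: a - b and c - d before the swap, a - c and
    b - d after it. Links parallel to the pairing cost no class; of two links across it, the first
    costs one class and the second nothing. Components are treated alike from [C], where a link
    across may also be free, and with the further link a - c before the swap, because the sides are
    present too. *)
Lemma rectangle_counts :
  [\/ [/\ R a b, R c d & ~~ R a c] /\ [/\ ~~ connect (step [:: g; f]) a c,
          nc [:: g; f] = (nc [:: mix D r g; f]).+1
        & nc [:: mix D r g; f; r] = nc [:: g; f; r]],
      [/\ R a c, R b d & ~~ R a b] /\ [/\ connect (step [:: g; f]) a c,
          nc [:: mix D r g; f] = (nc [:: g; f]).+1
        & nc [:: mix D r g; f; r] = nc [:: g; f; r] + ~~ connect C a b]
    | [/\ R a d, R b c, ~~ R a b & ~~ R a c] /\ [/\ connect (step [:: g; f]) a c,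
          nc [:: mix D r g; f] = nc [:: g; f]
        & nc [:: mix D r g; f; r] = nc [:: g; f; r]]].
Proof.
have sl (e : rel T) u v : ssrbool.symmetric e -> connect_sym (link e u v).
  by move=> sy; apply/sym_connect_sym/link_symmetric.
have sg : ssrbool.symmetric (step [:: g; f; offr]) := step3_sym gK fK orK.
have sgg : connect_sym (step [:: g; f; offr]) := sym_connect_sym sg.
have nV : nc [:: g; f] = #|classes (link (link B a b) c d)|.
  by rewrite (eq_classes (connect_g symB)).
have nV' : nc [:: mix D r g; f] = #|classes (link (link B a c) b d)|.
  by rewrite (eq_classes (connect_swap symB)).
have nK' : nc [:: mix D r g; f; r] = #|classes (link (link C a c) b d)|.
  by rewrite (eq_classes connect_swap_r) (eq_classes (connect_swap symC)).
have nK : nc [:: g; f; r] = #|classes (link (link (link C a b) c d) a c)|.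
  rewrite (eq_classes connect_g_r); congr #|pred_of_set _|.
  apply/eq_classes/eq_connect_link => //; first exact: sl (link_symmetric _ _ symC).
  exact: (connect_g symC).
have gac : connect (step [:: g; f]) a c = connect (link (link B a b) c d) a c.
  exact: (connect_g symB).
rewrite {}nV {}nV' {}nK {}nK' {}gac.
have [[ab cd ac]|[ac bd ab]|[ad bc ab ac]] := rectangle_pairing.
- constructor 1.
  have [abC cdC] := (sub_BC ab, sub_BC cd).
  have lcd e : ssrbool.symmetric e -> connect e a b -> connect e c d ->
      connect (link (link e a b) c d) =2 connect e.
    move=> se eab ecd x y; rewrite (connect_link_id (sl _ _ _ se) (sub_link a b ecd)).
    by rewrite (connect_link_id (sym_connect_sym se) eab).
  have bd e : ssrbool.symmetric e -> connect e a b -> connect e c d -> connect (link e a c) b d.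
    move=> se eab ecd; apply: (connect_trans (y := a)); first by rewrite sl // sub_link.
    by apply: connect_trans (connect_link_l e a c) _; apply: sub_link.
  split=> //; split; first by rewrite lcd.
    rewrite (eq_classes (lcd _ symB ab cd)) (card_classes_linkF symB ac).
    by rewrite (card_classes_linkT (link_symmetric a c symB) (bd _ symB ab cd)).
  rewrite (card_classes_linkT (link_symmetric a c symC) (bd _ symC abC cdC)).
  congr #|pred_of_set _|; apply/eq_classes/eq_connect_link => // [|x y]; first exact: sl (link_symmetric _ _ symC).
  by rewrite lcd.
- constructor 2.
  have [acC bdC] := (sub_BC ac, sub_BC bd).
  have lbd e : ssrbool.symmetric e -> connect e a c -> connect e b d ->
      connect (link (link e a c) b d) =2 connect e.
    move=> se eac ebd x y; rewrite (connect_link_id (sl _ _ _ se) (sub_link a c ebd)).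
    by rewrite (connect_link_id (sym_connect_sym se) eac).
  have cd e : ssrbool.symmetric e -> connect e a c -> connect e b d -> connect (link e a b) c d.
    move=> se eac ebd; apply: (connect_trans (y := a)); first by rewrite sl // sub_link.
    by apply: connect_trans (connect_link_l e a b) _; apply: sub_link.
  split=> //; split; first by do 2 apply: sub_link.
    rewrite (eq_classes (lbd _ symB ac bd)).
    rewrite (card_classes_linkT (link_symmetric a b symB) (cd _ symB ac bd)).
    exact: card_classes_linkF.
  rewrite (eq_classes (lbd _ symC acC bdC)).
  rewrite (card_classes_linkT (link_symmetric c d (link_symmetric a b symC))); last first.
    by do 2 apply: sub_link.
  rewrite (card_classes_linkT (link_symmetric a b symC) (cd _ symC acC bdC)).
  exact: card_classes_link.
- constructor 3.
  have [adC bcC] := (sub_BC ad, sub_BC bc).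
  have cd e : ssrbool.symmetric e -> connect e a d -> connect e b c -> connect (link e a b) c d.
    move=> se ead ebc; rewrite (sl _ _ _ se); apply: (connect_trans (y := a)).
      by rewrite sl // sub_link.
    by apply: connect_trans (connect_link_l e a b) _; apply: sub_link.
  have bd e : ssrbool.symmetric e -> connect e a d -> connect e b c -> connect (link e a c) b d.
    move=> se ead ebc; apply: (connect_trans (y := c)); first exact: sub_link.
    rewrite (sl _ _ _ se); apply: (connect_trans (y := a)); first by rewrite sl // sub_link.
    exact: connect_link_l.
  have ac' e : ssrbool.symmetric e -> connect e b c -> connect (link e a b) a c.
    by move=> se ebc; apply: connect_trans (connect_link_l e a b) _; apply: sub_link.
  split=> //; split; first by apply/sub_link/ac'.
    rewrite (card_classes_linkT (link_symmetric a c symB) (bd _ symB ad bc)).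
    rewrite (card_classes_linkT (link_symmetric a b symB) (cd _ symB ad bc)).
    by apply: succn_inj; rewrite -!card_classes_linkF.
  rewrite (card_classes_linkT (link_symmetric a c symC) (bd _ symC adC bcC)).
  rewrite (card_classes_linkT (link_symmetric c d (link_symmetric a b symC))); last first.
    by apply/sub_link/ac'.
  rewrite (card_classes_linkT (link_symmetric a b symC) (cd _ symC adC bcC)).
  have := card_classes_link a c symC; have := card_classes_link a b symC.
  by rewrite (same_connect_r csC bcC a); lia.
Qed.

Lemma rectangle_cut_count :
  nc [:: g; f; offr] = nc [:: g; f; r] + ~~ connect (step [:: g; f; offr]) a c.
Proof.
rewrite (eq_classes connect_g_r); apply: card_classes_link.
exact: step3_sym gK fK orK.
Qed.

End Rectangle.

(** * Invariants of a contraction *)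

(** A path that starts in this class never leaves [D], where both relations take the same steps. *)
Lemma sub_class_eq (T : finType) (D : {set T}) (e1 e2 : rel T) x :
  (forall u v, u \in D -> e1 u v = e2 u v) ->
  eqclass e1 x \subset D -> eqclass e2 x = eqclass e1 x.
Proof.
move=> E /subsetP sD; apply/setP=> y; rewrite !inE; apply/idP/idP=> xy.
  pose A := eqclass e1 x; suff: y \in A by rewrite inE.
  apply: (connect_invariant (A := mem A) _ _ xy); last by rewrite inE connect0.
  move=> u v uA; rewrite -E ?sD // => uv; rewrite inE; move: uA; rewrite inE => xu.
  exact: connect_trans xu (connect1 uv).
pose A := [pred y | connect e1 x y && connect e2 x y].
suff: y \in A by case/andP.
apply: (connect_invariant (A := mem A) _ _ xy); last by rewrite inE !connect0.
move=> u v /andP[xu xu'] uv; apply/andP; split.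
  exact: connect_trans xu (connect1 uv).
by apply: connect_trans xu' (connect1 _); rewrite -E // sD // inE.
Qed.

Lemma sub_classes_eq (T : finType) (D : {set T}) (e1 e2 : rel T) :
  (forall u v, u \in D -> e1 u v = e2 u v) ->
  [set C in classes e1 | C \subset D] = [set C in classes e2 | C \subset D].
Proof.
move=> E; apply/setP=> C; rewrite !inE; apply/andP/andP => -[/imsetP[x _ ->] sD].
  by rewrite -(sub_class_eq E) // imset_f // (sub_class_eq E).
have E' u v : u \in D -> e2 u v = e1 u v by move=> uD; rewrite E.
by rewrite -(sub_class_eq E') // imset_f // (sub_class_eq E').
Qed.

Lemma facesE H : faces H = classes (step [:: @arc H; rib]).
Proof. by []. Qed.

Lemma nb_verticesE H : nb_vertices H = #|classes (step [:: @seg H; arc])| + isolated H.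
Proof. by []. Qed.

Lemma nb_componentsE H :
  nb_components H = #|classes (step [:: @seg H; arc; rib])| + isolated H.
Proof. by []. Qed.

(* Up to isomorphism, A' is obtained from A by contracting the edges with flags
   in D; for D = set0 this says that A and A' are isomorphic. *)
Record contraction (A A' : herg) (D : {set flag A}) (io : flag A' -> flag A) : Prop :=
  Contraction {
  io_inj : injective io;
  io_notin : forall x, io x \notin D;
  io_onto : forall y, y \notin D -> exists x, io x = y;
  D_rib : forall x, (rib x \in D) = (x \in D);
  D_seg : forall x, (seg x \in D) = (x \in D);
  D_neq : forall x, x \in D -> rib x != x;
  io_seg : forall x, io (seg x) = seg (io x);
  io_rib : forall x, io (rib x) = rib (io x);
  io_arc : forall x, exists m, io (arc x) = walk arc rib m (io x) /\
                      forall i, i < m -> walk arc rib i (io x) \in D;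
  io_isolated : isolated A' = isolated A + #|[set f in faces A | f \subset D]| }.

Section Contraction.
Variables (A A' : herg) (D : {set flag A}) (io : flag A' -> flag A).
Hypothesis ct : contraction D io.

Section Transfer.
Variables (r : rel (flag A)) (r' : rel (flag A')).
Hypotheses (r1 : forall x y, r' x y -> r (io x) (io y))
  (r2 : forall x z, r (io x) z -> exists2 y, z = io y & r' x y)
  (r3 : forall z w, z \in D -> r z w -> w = rib z \/ w = z)
  (r4 : forall z, z \in D -> r z (rib z)).

(** An [arc] of [A'] is a walk of [A] through [D]. Conversely [D] is entered and left only along
    such walks: for the involution [g] equal to [rib] on [D] and to the identity elsewhere, both
    ends of the walk are fixed, so by [walk_setP] they are the only flags outside [D] on it. *)
Lemma connect_contraction (e : rel (flag A)) (e' : rel (flag A')) :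
  (forall u v, e u v = (v == arc u) || r u v) ->
  (forall u v, e' u v = (v == arc u) || r' u v) ->
  forall x y, connect e (io x) (io y) = connect e' x y.
Proof.
move=> eE eE' x y; apply/idP/idP => [xy|]; last first.
  pose P := [pred z | connect e (io x) (io z)].
  apply: (connect_invariant (A := mem P)); last exact: connect0.
  move=> u v uP; rewrite eE' => /orP[/eqP->|/r1 uv]; last first.
    by apply: connect_trans uP (connect1 _); rewrite eE uv orbT.
  have [m [mE mD]] := io_arc ct u.
  rewrite inE mE; apply: connect_trans uP _.
  have: forall i, i <= m -> connect e (io u) (walk arc rib i (io u)).
    elim=> [|i IHi] im; first by apply: connect1; rewrite eE /walk eqxx.
    apply: connect_trans (IHi (ltnW im)) _; have wD := mD i im.
    apply: connect_trans (connect1 _) (connect1 (_ : e (rib (walk arc rib i (io u))) _)).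
      by rewrite eE r4 // orbT.
    by rewrite eE eqxx.
  exact.
pose g := mix D rib id; have gK : involutive g.
  by apply: mixK => //; [exact: ribK | exact: D_rib ct].
pose P := [pred z | [exists x', connect e' x x' && connect (step [:: arc; g]) (io x') z]].
have ends x' z : connect (step [:: arc; g]) (io x') z -> z \notin D -> z = io x' \/ z = io (arc x').
  move=> xz zD; have [m [mE mD]] := io_arc ct x'.
  have wE i : i <= m -> walk arc g i (io x') = walk arc rib i (io x').
    elim: i => // i IHi im; rewrite /walk !iterS.
    have := IHi (ltnW im); have := mD i im; rewrite /walk => wD ->.
    by rewrite /g /mix wD.
  have gio : g (io x') = io x' by rewrite /g /mix (negbTE (io_notin ct x')).
  have gm : g (walk arc g m (io x')) = walk arc g m (io x').
    by rewrite wE // -mE /g /mix (negbTE (io_notin ct _)).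
  have [||[i im]] := walk_setP (@arcK A) gK gio gm xz; first by left.
    by rewrite wE // -mE; right.
  rewrite wE 1?ltnW // => /orP[]/eqP zE; move: zD; rewrite zE; first by rewrite mD.
  by rewrite /g /mix mD // (D_rib ct) mD.
have Parc x' : connect e' x x' -> connect e' x (arc x').
  by move=> xx'; apply: connect_trans xx' (connect1 _); rewrite eE' eqxx.
have : io y \in P.
  apply: (connect_invariant (A := mem P) _ _ xy); last first.
    by apply/existsP; exists x; rewrite !connect0.
  move=> u v /existsP[x' /andP[xx' x'u]]; rewrite eE => /orP[/eqP->|uv].
    apply/existsP; exists x'; rewrite xx'; apply: connect_trans x'u (connect1 _).
    by rewrite step2E eqxx.
  have [uD|uD] := boolP (u \in D).
    apply/existsP; exists x'; rewrite xx'; case: (r3 uD uv) => -> //.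
    by apply: connect_trans x'u (connect1 _); rewrite step2E /g /mix uD eqxx orbT.
  have [x'' uE xx''] : exists2 x'', u = io x'' & connect e' x x''.
    by case: (ends _ _ x'u uD) => ->; [exists x' | exists (arc x') => //; apply: Parc].
  rewrite uE in uv; have [w -> uw] := r2 uv.
  apply/existsP; exists w; rewrite connect0 andbT.
  by apply: connect_trans xx'' (connect1 _); rewrite eE' uw orbT.
case/existsP=> x' /andP[xx' /ends] -/(_ (io_notin ct y))[]/(io_inj ct) -> //.
exact: Parc.
Qed.

End Transfer.

Lemma card_classes_transfer (e : rel (flag A)) (e' : rel (flag A'))
    (P : pred {set flag A}) (P' : pred {set flag A'}) :
  connect_sym e -> (forall x y, connect e (io x) (io y) = connect e' x y) ->
  (forall x, P (eqclass e (io x)) = P' (eqclass e' x)) ->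
  #|[set C in classes e | P C & ~~ (C \subset D)]| = #|[set C in classes e' | P' C]|.
Proof.
move=> sy E EP; pose f (C : {set flag A}) := [set x | io x \in C].
have fE x : f (eqclass e (io x)) = eqclass e' x.
  by apply/setP=> y; rewrite !inE E.
have rep C : C \in classes e -> ~~ (C \subset D) -> exists x, C = eqclass e (io x).
  case/imsetP=> z _ ->{C} /subsetPn[w wz /(io_onto ct)[x xE]].
  by exists x; apply/eqP; rewrite eqclass_eq // xE; move: wz; rewrite inE.
rewrite -(@card_in_imset _ _ f) => [|C1 C2].
  congr #|pred_of_set _|; apply/setP=> K; rewrite inE; apply/imsetP/andP.
    case=> C; rewrite inE => /and3P[Ce PC CD] ->; have [x CE] := rep _ Ce CD.
    by rewrite CE fE -EP -CE; split=> //; apply: imset_f.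
  case=> /imsetP[x _ ->]; rewrite -EP => Px; exists (eqclass e (io x)); last by rewrite fE.
  rewrite inE Px imset_f //=; apply/subsetPn; exists (io x); last exact: io_notin ct x.
  by rewrite inE connect0.
rewrite !inE => /and3P[C1e _ C1D] /and3P[C2e _ C2D].
have [x1 ->] := rep _ C1e C1D; have [x2 ->] := rep _ C2e C2D.
rewrite !fE => /setP/(_ x2); rewrite !inE connect0 -E => x12.
by apply/eqP; rewrite eqclass_eq.
Qed.

Local Notation tau := (mix D rib (@seg A)).

Lemma tauK : involutive tau.
Proof. by apply: mixK; [exact: ribK | exact: segK | exact: D_rib ct | exact: D_seg ct]. Qed.

Lemma tau_neq x : tau x != x.
Proof. by rewrite /mix; case: ifP => [/(D_neq ct)|_] //; apply: seg_neq. Qed.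

Lemma connect_vertex_contraction x y :
  connect (step [:: tau; arc]) (io x) (io y) = connect (step [:: seg; arc]) x y.
Proof.
apply: (connect_contraction (r := [rel u v | v == tau u]) (r' := [rel u v | v == seg u])) => [u v|u z|z w|z|u v|u v] /=.
- by move/eqP->; rewrite /mix (negbTE (io_notin ct _)) (io_seg ct).
- by move/eqP->; rewrite /mix (negbTE (io_notin ct _)); exists (seg u); rewrite ?(io_seg ct).
- by move=> zD /eqP->; rewrite /mix zD; left.
- by move=> zD; rewrite /mix zD.
- by rewrite step2E orbC.
- by rewrite step2E orbC.
Qed.

Lemma connect_component_contraction x y :
  connect (step [:: tau; arc; rib]) (io x) (io y) = connect (step [:: seg; arc; rib]) x y.
Proof.
apply: (connect_contraction (r := [rel u v | (v == tau u) || (v == rib u)])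
   (r' := [rel u v | (v == seg u) || (v == rib u)])) => [u v|u z|z w|z|u v|u v] /=.
- by case/orP=> /eqP->; rewrite /mix (negbTE (io_notin ct _)) ?(io_seg ct) ?(io_rib ct) eqxx ?orbT.
- case/orP=> /eqP->; rewrite /mix ?(negbTE (io_notin ct _)).
    by exists (seg u); rewrite ?(io_seg ct) ?eqxx.
  by exists (rib u); rewrite ?(io_rib ct) ?eqxx ?orbT.
- by move=> zD; rewrite /mix zD orbb => /eqP; left.
- by move=> zD; rewrite /mix zD eqxx.
- by rewrite step3E orbCA.
- by rewrite step3E orbCA.
Qed.

Lemma connect_face_contraction x y :
  connect (step [:: arc; rib]) (io x) (io y) = connect (step [:: arc; rib]) x y.
Proof.
apply: (connect_contraction (r := [rel u v | v == rib u])
   (r' := [rel u v | v == rib u])) => [u v|u z|z w|z|u v|u v] //=.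
- by move/eqP->; rewrite (io_rib ct).
- by move/eqP->; exists (rib u); rewrite ?(io_rib ct).
- by move=> _ /eqP; left.
- by rewrite step2E.
- by rewrite step2E.
Qed.

(** On [D] the swapped segments are the sides, so the classes inside [D] are faces, namely those
    that the contraction turns into isolated vertices. The other classes are the vertices of [A']
    with flags. *)
Lemma nb_vertices_contraction :
  nb_vertices A' = #|classes (step [:: tau; arc])| + isolated A.
Proof.
rewrite /nb_vertices (io_isolated ct) addnA addnAC; congr (_ + _).
have E := @card_classes_transfer _ _ predT predT
  (sym_connect_sym (step2_sym tauK (@arcK A))) connect_vertex_contraction (fun=> erefl).
have -> : #|[set vertex x | x : flag A']| = #|[set C in classes (step [:: @seg A'; arc]) | predT C]|.
  by congr #|pred_of_set _|; apply/setP=> C; rewrite inE andbT.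
rewrite -E facesE -(@sub_classes_eq _ D (step [:: tau; arc])) => [|u v uD]; last first.
  by rewrite !step2E /mix uD orbC.
rewrite addnC -[RHS](cardsID (powerset D)); congr (_ + _); congr #|pred_of_set _|;
  by apply/setP=> C; rewrite !inE // andbC.
Qed.

Lemma nb_components_contraction :
  nb_components A' = #|classes (step [:: tau; arc; rib])| + isolated A.
Proof.
rewrite /nb_components (io_isolated ct) addnA addnAC; congr (_ + _).
have E := @card_classes_transfer _ _ predT predT
  (sym_connect_sym (step3_sym tauK (@arcK A) (@ribK A))) connect_component_contraction (fun=> erefl).
have -> : #|[set component x | x : flag A']| = #|[set C in classes (step [:: @seg A'; arc; rib]) | predT C]|.
  by congr #|pred_of_set _|; apply/setP=> C; rewrite inE andbT.
rewrite -E facesE -(@sub_classes_eq _ D (step [:: tau; arc; rib])) => [|u v uD]; last first.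
  by rewrite step2E step3E /mix uD orbCA orbb.
rewrite addnC -[RHS](cardsID (powerset D)); congr (_ + _); congr #|pred_of_set _|;
  by apply/setP=> C; rewrite !inE // andbC.
Qed.

(** A face inside [D] has only flags of edges, so it is closed; it disappears as a set of flags but
    returns as the boundary of a new isolated vertex. *)
Lemma nb_closed_faces_contraction : nb_closed_faces A' = nb_closed_faces A.
Proof.
rewrite /nb_closed_faces (io_isolated ct).
suff: #|closed_faces A'| + #|[set f in faces A | f \subset D]| = #|closed_faces A| by lia.
pose closed := fun H : herg => [pred f : {set flag H} | [forall x in f, rib x != x]].
have sy := sym_connect_sym (step2_sym (@arcK A) (@ribK A)).
have EP x : closed A (eqclass (step [:: arc; rib]) (io x)) = closed A' (eqclass (step [:: arc; rib]) x).
  apply/forall_inP/forall_inP => cl y; rewrite inE => xy.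
    have := cl (io y); rewrite inE connect_face_contraction => /(_ xy).
    by rewrite -(io_rib ct) (inj_eq (io_inj ct)).
  have [yD|/(io_onto ct)[z zE]] := boolP (y \in D); first exact: D_neq ct y yD.
  rewrite -zE -(io_rib ct) (inj_eq (io_inj ct)); apply: cl.
  by rewrite inE -connect_face_contraction zE.
have := card_classes_transfer sy connect_face_contraction EP.
rewrite -[closed_faces A']/[set C in faces A' | closed A' C] -facesE => <-.
rewrite addnC -[RHS](cardsID (powerset D)); congr (_ + _); congr #|pred_of_set _|;
  apply/setP=> C; rewrite !inE; last by rewrite andbA andbC.
rewrite -andbA; congr (_ && _); rewrite andbC; case: (boolP (C \subset D)) => //= /subsetP sD.
by apply/esym/forall_inP=> x /sD; apply: D_neq ct x.
Qed.

Lemma ribbon_contraction x : ribbon (io x) = io @: ribbon x.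
Proof.
by rewrite /ribbon !imsetU !imset_set1 !(io_seg ct) !(io_rib ct).
Qed.

Lemma hrs_contraction : hrs A = [set io @: a | a : {set flag A'} in hrs A'].
Proof.
apply/setP=> a; apply/imsetP/imsetP=> [[x]|[a' /imsetP[x]]].
  rewrite inE => rx ->; have /(io_onto ct)[y yE] : x \notin D.
    by apply: contraL rx; apply: D_neq ct x.
  move: rx; rewrite -yE -(io_rib ct) (inj_eq (io_inj ct)) => ry.
  by exists (ribbon y); rewrite ?ribbon_contraction // imset_f // inE.
rewrite inE => rx -> ->; exists (io x); last by rewrite ribbon_contraction.
by rewrite inE -(io_rib ct) (inj_eq (io_inj ct)).
Qed.

Lemma card_hrs_contraction : #|hrs A'| = #|hrs A|.
Proof. by rewrite hrs_contraction (card_imset _ (imset_inj (io_inj ct))). Qed.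

Lemma edges_contraction :
  edges A = [set io @: a | a : {set flag A'} in edges A'] :|: [set ribbon x | x in D].
Proof.
apply/setP=> a; rewrite inE; apply/imsetP/orP=> [[x]|].
  rewrite inE => rx ->; have [xD|/(io_onto ct)[y yE]] := boolP (x \in D).
    by right; apply: imset_f.
  left; rewrite -yE ribbon_contraction; apply: imset_f; apply: imset_f.
  by rewrite inE -(inj_eq (io_inj ct)) (io_rib ct) yE.
case=> /imsetP[].
  move=> a' /imsetP[x]; rewrite inE => rx -> ->; exists (io x); last by rewrite ribbon_contraction.
  by rewrite inE -(io_rib ct) (inj_eq (io_inj ct)).
by move=> x xD ->; exists x => //; rewrite inE; apply: D_neq ct x xD.
Qed.

Lemma card_edges_contraction : #|edges A| = #|edges A'| + #|[set ribbon x | x in D]|.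
Proof.
rewrite edges_contraction cardsU (card_imset _ (imset_inj (io_inj ct))).
rewrite (_ : _ :&: _ = set0) ?cards0 ?subn0 //; apply/setP=> a; rewrite !inE.
apply/negbTE/negP=> /andP[/imsetP[a' /imsetP[x _ ->] ->] /imsetP[y yD]].
rewrite -ribbon_contraction => /setP/(_ (io x)); rewrite !inE eqxx /=.
move/esym; rewrite -!orbA => /or4P[]/eqP E; move: (io_notin ct x); rewrite E;
  by rewrite ?(D_seg ct) ?(D_rib ct) yD.
Qed.

(** A face that meets a half-edge contains a flag fixed by [rib], hence is open without further
    condition. *)
Lemma boundary_adjE (H : herg) (a b : {set flag H}) :
  boundary_adj a b = [&& a \in hrs H, b \in hrs H
    & [exists u in a, [exists v in b, connect (step [:: arc; rib]) u v]]].
Proof.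
rewrite /boundary_adj; case: (boolP (a \in hrs H)) => //= /imsetP[x]; rewrite inE => rx aE.
case: (boolP (b \in hrs H)) => //= _.
have sy := sym_connect_sym (step2_sym (@arcK H) (@ribK H)).
apply/exists_inP/exists_inP => [[f]|[u ua /exists_inP[v vb uv]]].
  rewrite inE => /andP[_ /imsetP[z _ ->]] /andP[/set0Pn[u /setIP[ua]] +/set0Pn[v /setIP[vb]]].
  rewrite !inE => zu zv; exists u => //; apply/exists_inP; exists v => //.
  by apply: connect_trans zv; rewrite sy.
exists (face u).
  rewrite in_setD [face u \in faces H]imset_f // andbT inE [face u \in faces H]imset_f //= negb_forall_in.
  apply/exists_inP; exists u; rewrite ?inE ?connect0 // negbK.
  by move: ua; rewrite aE !inE -!orbA => /or4P[]/eqP->; rewrite ?rib_seg ?ribK ?(eqP rx) ?(eqP rx).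
by apply/andP; split; apply/set0Pn; [exists u|exists v]; rewrite !inE ?ua ?vb ?connect0.
Qed.

Lemma nb_boundary_components_contraction :
  nb_boundary_components A' = nb_boundary_components A.
Proof.
have sym (H : herg) : ssrbool.symmetric (@boundary_adj H).
  move=> a b; rewrite /boundary_adj andbCA; do 2 congr (_ && _).
  by apply: eq_existsb => f; rewrite [in RHS]andbC andbC; congr (_ && _); rewrite andbC.
have cl : closed (@boundary_adj A) (hrs A).
  by move=> a b /and3P[-> -> _].
pose h (a : {set flag A'}) := io @: a.
have hin a : (h a \in hrs A) = (a \in hrs A').
  by rewrite hrs_contraction mem_imset //; apply: imset_inj (io_inj ct).
rewrite /nb_boundary_components.
rewrite (@adjunction_n_comp _ _ h _ (@boundary_adj A') _ _ _ cl).
- by apply: eq_n_comp_r => a; rewrite [RHS]inE hin.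
- exact/sym_connect_sym/sym.
- exact/sym_connect_sym/sym.
apply: strict_adjunction => //.
- exact/sym_connect_sym/sym.
- exact: imset_inj (io_inj ct).
- by apply/subsetP=> a; rewrite hrs_contraction => /imsetP[b _ ->]; apply: codom_f.
move=> a b; rewrite !boundary_adjE !hin => _; do 2 congr (_ && _).
apply/exists_inP/exists_inP => [[_ /imsetP[u ua ->] /exists_inP[_ /imsetP[v vb ->]]]|[u ua /exists_inP[v vb uv]]].
  by rewrite connect_face_contraction => uv; exists u => //; apply/exists_inP; exists v.
exists (io u); rewrite ?imset_f //; apply/exists_inP; exists (io v); rewrite ?imset_f //.
by rewrite connect_face_contraction.
Qed.

End Contraction.

(** * Loops and orientability *)

Section Isomorphism.
Variables (A A' : herg) (io : flag A' -> flag A).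
Hypotheses (inj : injective io) (onto : forall y, exists x, io x = y).
Hypotheses (io_s : forall x, io (seg x) = seg (io x))
  (io_r : forall x, io (rib x) = rib (io x)) (io_a : forall x, io (arc x) = arc (io x))
  (io_i : isolated A' = isolated A).

Lemma contraction_set0 : contraction set0 io.
Proof.
split=> //; do ?by move=> x; rewrite ?inE.
  by move=> x; exists 0.
rewrite io_i (_ : [set f in _ | _] = set0) ?cards0 ?addn0 //.
apply/setP=> f; rewrite !inE; apply/negbTE/negP=> /andP[/imsetP[x _ ->] /subsetP/(_ x)].
by rewrite !inE connect0 => /(_ isT).
Qed.

End Isomorphism.

Section Ribbons.
Variable H : herg.
Implicit Types x y a : flag H.

Lemma mem_ribbon x a : (x \in ribbon a) = (ribbon x == ribbon a).
Proof.
apply/idP/eqP=> [|<-]; last by rewrite !inE eqxx.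
by rewrite !inE -!orbA => /or4P[]/eqP->; rewrite ?ribbon_seg ?ribbon_rib ?ribbon_seg.
Qed.

Lemma rib_neq_ribbon x a : x \in ribbon a -> (rib x == x) = (rib a == a).
Proof.
have seg_inj := can_inj (@segK H); have rib_inj := can_inj (@ribK H).
rewrite !inE -!orbA => /or4P[]/eqP-> //.
- by rewrite rib_seg (inj_eq seg_inj).
- by rewrite (inj_eq rib_inj).
- by rewrite rib_seg (inj_eq seg_inj) (inj_eq rib_inj).
Qed.

Lemma edges_ribbon a : (ribbon a \in edges H) = (rib a != a).
Proof.
apply/imsetP/idP=> [[x]|ra]; last by exists a; rewrite ?inE.
by rewrite inE => rx /eqP; rewrite -mem_ribbon => /rib_neq_ribbon->.
Qed.

Lemma uniq_ribbon a : rib a != a -> uniq [:: a; seg a; rib a; seg (rib a)].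
Proof.
move=> ra; have seg_inj := can_inj (@segK H).
have n3 : a != seg (rib a).
  by rewrite (eq_inv _ _ (@segK H)) rib_neq_seg.
rewrite /= !inE !negb_or andbT n3 (inj_eq seg_inj).
by rewrite [a == seg a]eq_sym seg_neq ![a == rib a]eq_sym ra [seg a == _]eq_sym rib_neq_seg
  [rib a == seg _]eq_sym seg_neq.
Qed.

(** Opening the two segments of the ribbon leaves the boundary arcs of its end vertices. In
    [component_off] the sides are removed too: this is connectivity away from the ribbon, where the
    two arcs left by one disc may be separated. *)
Definition vertex_off a := step [:: mix (ribbon a) id seg; arc].
Definition component_off a := step [:: mix (ribbon a) id seg; arc; mix (ribbon a) id rib].

Lemma loopE a : loop (ribbon a) = (rib a \in vertex a).
Proof.
have sy := sym_connect_sym (step2_sym (@segK H) (@arcK H)).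
have vs x : connect (step [:: seg; arc]) x (seg x) by apply: connect1; rewrite step2E eqxx.
rewrite inE; apply/forall_inP/idP => [/(_ a)|ca x]; first by rewrite !inE eqxx => /(_ isT).
rewrite !inE -!orbA => /or4P[]/eqP-> //.
- rewrite rib_seg; apply: (connect_trans (y := a)); first by rewrite sy; apply: vs.
  exact: connect_trans ca (vs _).
- by rewrite ribK -[connect _ _ _]/(connect (step [:: seg; arc]) (rib a) a) sy.
- rewrite rib_seg ribK -[connect _ _ _]/(connect (step [:: seg; arc]) (seg (rib a)) (seg a)).
  rewrite sy; apply: (connect_trans (y := a)); first by rewrite sy; apply: vs.
  exact: connect_trans ca (vs _).
Qed.

Lemma orientableP : reflect (exists c : pred (flag H),
  [/\ forall x, c (seg x) = ~~ c x, forall x, c (arc x) = ~~ c x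
    & forall x, rib x != x -> c (rib x) = ~~ c x]) (orientable H).
Proof.
apply: (iffP existsP) => [[c /forallP cP]|[c [cs ca cr]]].
  exists (mem c); split=> x; have /and3P[/eqP s /eqP a /implyP r] := cP x.
  - exact: s.
  - exact: a.
  - by move=> /r/eqP.
exists [set x | c x]; apply/forallP=> x; rewrite !inE cs ca !eqxx /=.
by apply/implyP=> rx; rewrite cr.
Qed.

End Ribbons.

Section Sides.
Variables (H : herg) (a : flag H).
Hypothesis ra : rib a != a.
Let D := ribbon a.
Local Notation og := (mix D id (@seg H)).

Lemma ribbon_closed_rib x : (rib x \in D) = (x \in D).
Proof. by rewrite !mem_ribbon ribbon_rib. Qed.
Lemma ribbon_closed_seg x : (seg x \in D) = (x \in D).
Proof. by rewrite !mem_ribbon ribbon_seg. Qed.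

Let ogK : involutive og.
Proof. by apply: mixK => //; [exact: segK | exact: ribbon_closed_seg]. Qed.
Let sy : connect_sym (vertex_off a) := sym_connect_sym (step2_sym ogK (@arcK H)).

Lemma ribbon_pairing :
  let R := connect (vertex_off a) in
  [\/ [/\ R a (seg a), R (rib a) (seg (rib a)) & ~~ R a (rib a)],
      [/\ R a (rib a), R (seg a) (seg (rib a)) & ~~ R a (seg a)]
    | [/\ R a (seg (rib a)), R (seg a) (rib a), ~~ R a (seg a) & ~~ R a (rib a)]].
Proof.
exact: (rectangle_pairing (@arcK H) (@segK H) (@arc_neq H) (@seg_neq H)
  erefl erefl (uniq_ribbon ra)).
Qed.

Definition ribbon_counts :=
  rectangle_counts (@arcK H) (@segK H) (@ribK H) (@arc_neq H) (@seg_neq H)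
  erefl erefl erefl (rib_seg a) (uniq_ribbon ra).

(** A vertex with only one segment of the ribbon leaves a single arc, which joins the two ends of
    that segment; a vertex with both leaves two arcs, each going from one segment to the other. *)
Lemma loop_pairing :
  loop (ribbon a) = ~~ (connect (vertex_off a) a (seg a)).
Proof.
by rewrite loopE inE; case: ribbon_counts => -[] => [[-> _ _] [/negbTE-> _ _]|[_ _ ->] [-> _ _]|[_ _ -> _] [-> _ _]].
Qed.

Lemma vertex_off_flip (c : pred (flag H)) x y :
  (forall x, c (arc x) = ~~ c x) -> (forall x, x \notin D -> c (seg x) = ~~ c x) ->
  x \in D -> y \in D -> connect (vertex_off a) x y -> y != x -> c y = ~~ c x.
Proof.
move=> ca cs xD yD xy; apply: (ends_flip (@arcK H) ogK (@arc_neq H)) => //.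
- by move=> u; rewrite /mix; case: ifP => [_|/negbT/cs]; rewrite ?eqxx.
- by rewrite /mix xD.
- by rewrite /mix yD.
- by rewrite (eq_connect (e' := vertex_off a)) // => u v; rewrite /vertex_off !step2E orbC.
Qed.

Let in4 : [/\ a \in D, seg a \in D, rib a \in D & seg (rib a) \in D].
Proof. by rewrite !inE !eqxx !orbT. Qed.

Lemma flip_seg (c : pred (flag H)) :
  (forall x, x \notin D -> c (seg x) = ~~ c x) ->
  c (seg a) = ~~ c a -> c (seg (rib a)) = ~~ c (rib a) -> forall x, c (seg x) = ~~ c x.
Proof.
move=> cs ca cc x; case: (boolP (x \in D)) => [|/cs //].
by rewrite !inE -!orbA => /or4P[]/eqP->; rewrite ?segK ?ca ?cc ?negbK.
Qed.

Lemma flip_rib (c : pred (flag H)) :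
  c (rib a) = ~~ c a -> c (seg (rib a)) = ~~ c (seg a) -> forall x, x \in D -> c (rib x) = ~~ c x.
Proof.
move=> ca cc x; rewrite !inE -!orbA => /or4P[]/eqP->;
  by rewrite ?rib_seg ?ribK ?ca ?cc ?negbK.
Qed.

Let neqs : [/\ seg a != a, rib a != a, seg (rib a) != a, seg (rib a) != seg a & seg (rib a) != rib a].
Proof.
have := uniq_ribbon ra; rewrite /= !inE !negb_or andbT => /and3P[/and3P[_ _ n1] /andP[_ n2] _].
by split; rewrite ?seg_neq // eq_sym.
Qed.

(** The boundary arc forces opposite colours at [a] and at the diagonal corner [seg (rib a)], while
    [rib] and [seg] together force equal ones. *)
Lemma twisted_not_orientable :
  loop (ribbon a) -> ~~ connect (vertex_off a) a (rib a) -> ~~ orientable H.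
Proof.
rewrite loop_pairing => nab nac; apply/negP=> /orientableP[c [cs ca cr]].
case: ribbon_pairing => [[ab]|[ac]|[ad _ _ _]]; first by rewrite ab in nab.
  by rewrite ac in nac.
case: in4 neqs => [aD _ _ dD] [_ _ nda _ _].
have := vertex_off_flip ca (fun x _ => cs x) aD dD ad nda.
by rewrite cs cr // negbK; case: (c a).
Qed.

End Sides.

(** The vertex discs alone can always be oriented, by [two_colouring]. Only one ribbon constrains
    the result, and the arc from [a] to [rib a] already gives these flags opposite colours. *)
Lemma untwisted_orientable (H : herg) (a : flag H) :
  (forall x, x \notin ribbon a -> rib x = x) ->
  rib a != a -> connect (vertex_off a) a (rib a) -> orientable H.
Proof.
move=> rx ra ac; apply/orientableP.
have [c [ca cs]] := two_colouring (@arcK H) (@segK H) (@arc_neq H) (@seg_neq H).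
exists c; split=> // x rxx; apply: (flip_rib (a := a)).
- by apply: (vertex_off_flip ca (fun x _ => cs x)) ac ra; rewrite !inE eqxx ?orbT.
- have bd : connect (vertex_off a) (seg a) (seg (rib a)).
    by case: (ribbon_pairing ra) => [[_ _]|[]|[_ _ _]]; rewrite ?ac.
  apply: (vertex_off_flip ca (fun x _ => cs x)) bd _; rewrite ?inE ?eqxx ?orbT //.
  by rewrite (inj_eq (can_inj (@segK H))).
- by apply: contraNT rxx => /rx->.
Qed.

Lemma nb_components_le_vertices H : nb_components H <= nb_vertices H.
Proof.
rewrite nb_verticesE nb_componentsE leq_add2r; apply: card_classes_sub.
- exact: sym_connect_sym (step2_sym (@segK H) (@arcK H)).
- exact: sym_connect_sym (step3_sym (@segK H) (@arcK H) (@ribK H)).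
apply: connect_sub => x y; rewrite step2E => xy; apply: connect1.
by rewrite step3E orbA xy.
Qed.

Lemma orientable_contraction (A A' : herg) (D : {set flag A}) (io : flag A' -> flag A) :
  contraction D io -> orientable A -> orientable A'.
Proof.
move=> ct; case/orientableP=> c [cs ca cr]; apply/orientableP; exists (fun x => c (io x)).
split=> x; first by rewrite (io_seg ct) cs.
  have [m [-> mD]] := io_arc ct x.
  have: forall i, i <= m -> c (walk arc rib i (io x)) = ~~ c (io x).
    elim=> [|i IHi] im; first exact: ca.
    by rewrite /walk /= ca cr ?negbK ?IHi 1?ltnW // (D_neq ct) // mD.
  exact.
by rewrite -(inj_eq (io_inj ct)) (io_rib ct) => /cr.
Qed.

Section EdgeContraction.
Variables (A A' : herg) (a : flag A) (io : flag A' -> flag A).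
Hypotheses (ra : rib a != a) (ct : contraction (ribbon a) io).
Local Notation D := (ribbon a).
Local Notation tau := (mix D rib (@seg A)).

Lemma edge_contraction_counts :
  [\/ [/\ ~~ loop D, nb_vertices A = (nb_vertices A').+1
        & nb_components A' = nb_components A],
      [/\ loop D, connect (vertex_off a) a (rib a), nb_vertices A' = (nb_vertices A).+1
        & nb_components A' = nb_components A + ~~ connect (component_off a) a (seg a)]
    | [/\ loop D, ~~ connect (vertex_off a) a (rib a), nb_vertices A' = nb_vertices A
        & nb_components A' = nb_components A]].
Proof.
rewrite !loop_pairing // (nb_vertices_contraction ct) (nb_components_contraction ct).
rewrite nb_verticesE nb_componentsE.
case: (ribbon_counts ra) => -[] => [[-> cd nac] [_ -> ->]|[ac bd /negbTE->] [_ -> ->]|[ad bc /negbTE-> nac] [_ -> ->]].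
- by constructor 1.
- by constructor 2; split=> //; rewrite addnAC.
- by constructor 3.
Qed.

Lemma card_edges_edge_contraction : #|edges A| = #|edges A'|.+1.
Proof.
rewrite (card_edges_contraction ct) (_ : [set ribbon x | x in D] = [set D]).
  by rewrite cards1 addn1.
apply/setP=> b; rewrite inE; apply/imsetP/eqP=> [[x]|->].
  by rewrite mem_ribbon => /eqP-> ->.
by exists a; rewrite // mem_ribbon.
Qed.

Let sy_tau : connect_sym (step [:: tau; arc]) :=
  sym_connect_sym (step2_sym (tauK ct) (@arcK A)).

(* The orientation of A' differs from a two-colouring of the flags of A under
   arc and tau by a function which is constant on the vertices of A'; this
   function extends to A. *)
Lemma orientation_extension : orientable A' -> exists c : pred (flag A),
  [/\ forall x, c (tau x) = ~~ c x, forall x, c (arc x) = ~~ c x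
    & forall x, rib x != x -> c (rib x) = ~~ c x].
Proof.
case/orientableP=> c [cs ca cr].
have [c0 [c0t c0a]] := two_colouring (tauK ct) (@arcK A) (tau_neq ct) (@arc_neq A).
have c0s x : c0 (io (seg x)) = ~~ c0 (io x).
  by rewrite (io_seg ct) -c0t /mix (negbTE (io_notin ct x)).
have c0a' x : c0 (io (arc x)) = ~~ c0 (io x).
  have [m [-> mD]] := io_arc ct x.
  have: forall i, i <= m -> c0 (walk arc rib i (io x)) = ~~ c0 (io x).
    elim=> [|i IHi] im; first exact: c0a.
    have := c0t (walk arc rib i (io x)); rewrite {1}/mix mD // => E.
    by rewrite /walk /= c0a E negbK IHi // ltnW.
  exact.
have const x y : connect (step [:: seg; arc]) x y -> (c x (+) c0 (io x)) = (c y (+) c0 (io y)).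
  pose P := [pred y | (c x (+) c0 (io x)) == (c y (+) c0 (io y))].
  move=> xy; suff: y \in P by move/eqP.
  apply: (connect_invariant (A := mem P) _ _ xy); last by rewrite inE.
  move=> u v; rewrite inE step2E => /eqP uP /orP[]/eqP->; rewrite inE uP.
    by rewrite cs c0s addNb addbN negbK.
  by rewrite ca c0a' addNb addbN negbK.
pose delta z := [exists x, connect (step [:: tau; arc]) (io x) z && (c x (+) c0 (io x))].
have dE x : delta (io x) = c x (+) c0 (io x).
  apply/existsP/idP => [[y /andP[]]|cx]; last by exists x; rewrite connect0.
  by rewrite (connect_vertex_contraction ct) => /const->.
have dc u v : connect (step [:: tau; arc]) u v -> delta u = delta v.
  move=> uv; apply: eq_existsb => x; congr (_ && _).
  by rewrite !(sy_tau (io x)); apply: (same_connect sy_tau).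
exists (fun z => c0 z (+) delta z); split=> x.
- by rewrite c0t addNb; congr (~~ (_ (+) _)); apply: dc; rewrite sy_tau connect1 // step2E eqxx.
- by rewrite c0a addNb; congr (~~ (_ (+) _)); apply: dc; rewrite sy_tau connect1 // step2E eqxx orbT.
have [xD _|/(io_onto ct)[y <-]] := boolP (x \in D).
  have E : tau x = rib x by rewrite /mix xD.
  rewrite -E c0t addNb; congr (~~ (_ (+) _)); apply: dc.
  by rewrite sy_tau connect1 // step2E eqxx.
rewrite -(io_rib ct) (inj_eq (io_inj ct)) => /cr E.
by rewrite !dE E addNb addbN; congr (~~ _); rewrite ![c0 _ (+) _]addbC -!addbA !addbb !addbF.
Qed.

Let tau_off x : x \notin D -> tau x = seg x. Proof. by rewrite /mix => /negbTE->. Qed.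
Let in4 : [/\ a \in D, seg a \in D, rib a \in D & seg (rib a) \in D].
Proof. by rewrite !inE !eqxx !orbT. Qed.

(** The extended colouring could fail only on the two segments of the edge, but a boundary arc joins
    the ends of each of them and the colours at its ends differ. *)
Lemma orientable_nonloop : ~~ loop D -> orientable A' = orientable A.
Proof.
rewrite loop_pairing // negbK => ab; apply/idP/idP; last exact: orientable_contraction ct.
case/orientation_extension=> c [ct' ca cr]; apply/orientableP; exists c; split=> //.
have cs x : x \notin D -> c (seg x) = ~~ c x by move=> /tau_off <-.
have cd : connect (vertex_off a) (rib a) (seg (rib a)).
  by case: (ribbon_pairing ra) => [[]|[_ _]|[_ _]] //; rewrite ab.
case: in4 => aD bD cD dD.
apply: (flip_seg cs); apply: (vertex_off_flip ca cs) => //; exact: seg_neq.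
Qed.

Let sy_C : connect_sym (component_off a).
Proof.
apply/sym_connect_sym/step3_sym; [|exact: arcK|].
  by apply: mixK => //; [exact: segK | exact: ribbon_closed_seg].
by apply: mixK => //; [exact: ribK | exact: ribbon_closed_rib].
Qed.

(** The colouring obtained from [A'] is right on the sides of the edge, so it is wrong on both of
    its segments or on none. The set [X] of flags joined to [seg a] off the edge contains exactly
    one end of each segment; reversing the colours on [X] repairs both and disturbs nothing else. *)
Lemma orientable_separating : connect (vertex_off a) a (rib a) ->
  ~~ connect (component_off a) a (seg a) -> orientable A' = orientable A.
Proof.
move=> ac nab; apply/idP/idP; last exact: orientable_contraction ct.
case/orientation_extension=> c [ct' ca cr].
have sub : subrel (connect (vertex_off a)) (connect (component_off a)) := @sub_BC _ _ _ _ _ _ _ _.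
have bd : connect (vertex_off a) (seg a) (seg (rib a)).
  by case: (ribbon_pairing ra) => [[_ _]|[]|[_ _ _]] //; rewrite ac.
case: in4 => aD bD cD dD.
pose X := connect (component_off a) (seg a).
have Xb : X (seg a) by apply: connect0.
have Xd : X (seg (rib a)) by apply: sub.
have Xa : X a = false by rewrite /X sy_C; apply/negbTE.
have Xc : X (rib a) = false.
  by apply/negbTE; apply: contra nab => Xc; rewrite sy_C; apply: connect_trans Xc _; rewrite sy_C sub.
have Xstep x y : component_off a x y -> X y = X x.
  by move=> xy; rewrite /X; apply/esym/(same_connect_r sy_C)/connect1.
have Xarc x : X (arc x) = X x by apply: Xstep; rewrite /component_off step3E eqxx orbT.
have Xseg x : x \notin D -> X (seg x) = X x.
  by move=> xD; apply: Xstep; rewrite /component_off step3E /mix (negbTE xD) eqxx.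
have Xrib x : x \notin D -> X (rib x) = X x.
  by move=> xD; apply: Xstep; rewrite /component_off step3E /mix (negbTE xD) eqxx !orbT.
pose k := c (seg a) == c a.
pose c1 x := c x (+) (k && X x).
apply/orientableP; exists c1.
have c1a x : c1 (arc x) = ~~ c1 x by rewrite /c1 ca Xarc addNb.
have c1s x : x \notin D -> c1 (seg x) = ~~ c1 x.
  by move=> xD; rewrite /c1 Xseg // -tau_off // ct' addNb.
have rb : rib (seg a) != seg a by rewrite rib_seg (inj_eq (can_inj (@segK A))).
split=> //.
  apply: (flip_seg c1s); rewrite /c1 ?Xa ?Xb ?Xc ?Xd ?andbT ?andbF ?addbF.
    by rewrite /k; case: (c (seg a)) (c a) => [] [].
  rewrite -rib_seg (cr _ rb) (cr _ ra).
  by rewrite /k; case: (c (seg a)) (c a) => [] [].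
move=> x rx; have [|xD] := boolP (x \in D); last by rewrite /c1 Xrib // cr // addNb.
apply: flip_rib; rewrite /c1 ?Xa ?Xb ?Xc ?Xd ?andbT ?andbF ?addbF; first by rewrite cr.
by rewrite -rib_seg cr // addNb.
Qed.

End EdgeContraction.

(** * Cuts and contractions *)

Section CutRibbon.
Variables (H : herg) (S : {set {set flag H}}).

Lemma cut_ribE (x : flag H) : ribbon x \notin S -> @rib (cut S) x = rib x.
Proof. by rewrite /rib /= /cut_rib => /negbTE->. Qed.

Lemma cut_rib_id (x : flag H) : ribbon x \in S -> @rib (cut S) x = x.
Proof. by rewrite /rib /= /cut_rib => ->. Qed.

Lemma ribbon_cut (x : flag H) : ribbon x \notin S -> @ribbon (cut S) x = ribbon x.
Proof. by move=> xS; rewrite /ribbon !cut_ribE. Qed.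

Lemma cut_rib_neq (x : flag H) :
  (@rib (cut S) x != x) = (ribbon x \notin S) && (rib x != x).
Proof. by rewrite /rib /= /cut_rib; case: ifP => xS; rewrite ?eqxx. Qed.

Lemma edges_cut : edges (cut S) = edges H :\: S.
Proof.
apply/setP=> b; rewrite inE; apply/imsetP/andP => [[x]|[bS /imsetP[x rx bE]]].
  rewrite inE cut_rib_neq => /andP[xS rx] ->; rewrite ribbon_cut //.
  by rewrite edges_ribbon.
rewrite bE in bS; exists x; rewrite ?ribbon_cut //.
by rewrite inE cut_rib_neq bS; rewrite inE in rx.
Qed.

Lemma vertex_off_cut (x : flag H) : ribbon x \notin S ->
  connect (@vertex_off (cut S) x) =2 connect (vertex_off x).
Proof. by move=> xS; apply: eq_connect => u v; rewrite /vertex_off ribbon_cut. Qed.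

Lemma component_off_cut (x : flag H) : ribbon x \notin S ->
  subrel (connect (@component_off (cut S) x)) (connect (component_off x)).
Proof.
move=> xS; apply: connect_sub => u v; rewrite /component_off ribbon_cut // step3E.
case/or3P=> /eqP->; try by apply: connect1; rewrite step3E eqxx ?orbT.
have [uS|uS] := boolP (@ribbon H u \in S).
  by rewrite /mix cut_rib_id // if_same; apply: connect0.
by apply: connect1; rewrite step3E /mix cut_ribE // eqxx !orbT.
Qed.

Lemma nb_components_cut : nb_components H <= nb_components (cut S).
Proof.
rewrite !nb_componentsE leq_add2r; apply: card_classes_sub.
- exact: sym_connect_sym (step3_sym (@segK (cut S)) (@arcK (cut S)) (@ribK (cut S))).
- exact: sym_connect_sym (step3_sym (@segK H) (@arcK H) (@ribK H)).
apply: connect_sub => u v; rewrite step3E.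
case/or3P=> /eqP->; try by apply: connect1; rewrite step3E eqxx ?orbT.
have [uS|uS] := boolP (@ribbon H u \in S); first by rewrite cut_rib_id.
by apply: connect1; rewrite step3E cut_ribE // eqxx !orbT.
Qed.

End CutRibbon.

Lemma contraction_cut_cut H (S1 S2 : {set {set flag H}}) :
  @contraction (cut (S1 :|: S2)) (@cut (cut S1) S2) set0 id.
Proof.
apply: contraction_set0 => // [y|x]; first by exists y.
rewrite -[LHS]/(@cut_rib (cut S1) S2 x) -[RHS]/(@cut_rib H (S1 :|: S2) x) /cut_rib in_setU.
have [x1|x1] := boolP (@ribbon H x \in S1); first by rewrite cut_rib_id // if_same.
by rewrite ribbon_cut // cut_ribE.
Qed.

Lemma contract_flags1 H (a : flag H) : rib a != a -> contract_flags [set ribbon a] = ribbon a.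
Proof.
move=> ra; apply/setP=> x; rewrite inE in_set1 -mem_ribbon.
by case: (boolP (x \in _)) => //= /rib_neq_ribbon ->.
Qed.

Lemma contraction_contract H (S : {set {set flag H}}) :
  @contraction H (contract S) (contract_flags S) (@of_contract_flag H S).
Proof.
split=> //.
- exact: val_inj.
- by move=> x; apply: (valP x).
- by move=> y yD; exists (Sub y yD).
- by move=> x; apply: contract_flags_rib.
- by move=> x; apply: contract_flags_seg.
- by move=> x; rewrite inE => /andP[].
by move=> x; have [m [mE _ mD]] := contract_arcP (valP x); exists m.
Qed.

Section CutContraction.
Variables (H K : herg) (D : {set flag H}) (io : flag K -> flag H).
Variables (S : {set {set flag H}}) (S' : {set {set flag K}}).
Hypotheses (ct : contraction D io) (DS : forall x, x \in D -> ribbon x \notin S).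
Hypothesis SE : forall x, (ribbon x \in S') = (ribbon (io x) \in S).

(** The walks hidden in the arcs of a contraction use only sides of edges of [D], none of which is
    cut, so cutting and contracting commute. *)
Lemma contraction_cut : @contraction (cut S) (cut S') D io.
Proof.
have ribD x : x \in D -> @rib (cut S) x = rib x by move=> /DS xS; rewrite cut_ribE.
split.
- exact: (io_inj ct).
- exact: (io_notin ct).
- exact: (io_onto ct).
- move=> x; rewrite -[@rib (cut S) x]/(@cut_rib H S x) /cut_rib.
  by case: ifP => // _; apply: (D_rib ct).
- exact: (D_seg ct).
- by move=> x xD; rewrite ribD //; apply: (D_neq ct).
- exact: (io_seg ct).
- move=> x; rewrite -[@rib (cut S') x]/(cut_rib S' x).
  by rewrite -[RHS]/(cut_rib S (io x)) /cut_rib -SE; case: ifP => // _; apply: (io_rib ct).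
- move=> x; have [m [mE mD]] := io_arc ct x; exists m.
  have wE i : i <= m -> @walk _ (@arc (cut S)) (@rib (cut S)) i (io x) = walk arc rib i (io x).
    elim: i => // i IHi im; rewrite /walk !iterS; have := IHi (ltnW im).
    rewrite /walk => ->; congr arc; apply: ribD; exact: mD.
  by split=> [|i im]; rewrite wE ?mD // ltnW.
rewrite /= (io_isolated ct); congr (_ + _); rewrite !facesE.
congr #|pred_of_set _|; apply: sub_classes_eq => u v /ribD uE.
by rewrite !step2E uE.
Qed.

End CutContraction.

Lemma edge_counts (A A' : herg) (a : flag A) (io : flag A' -> flag A) :
  rib a != a -> contraction (ribbon a) io ->
  [\/ [/\ connect (vertex_off a) a (seg a), nb_vertices A = (nb_vertices A').+1
        & nb_components A' = nb_components A],
      [/\ ~~ connect (vertex_off a) a (seg a), connect (vertex_off a) a (rib a),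
          nb_vertices A' = (nb_vertices A).+1
        & nb_components A' = nb_components A + ~~ connect (component_off a) a (seg a)]
    | [/\ ~~ connect (vertex_off a) a (seg a), ~~ connect (vertex_off a) a (rib a),
          nb_vertices A' = nb_vertices A & nb_components A' = nb_components A]].
Proof.
move=> ra ct; have := edge_contraction_counts ra ct.
rewrite !(loop_pairing ra) negbK.
case=> [[-> -> ->]|[-> -> -> ->]|[-> -> -> ->]].
- by constructor 1.
- by constructor 2.
- by constructor 3.
Qed.

Lemma contraction_contract1 H (a : flag H) : rib a != a ->
  @contraction H (contract [set ribbon a]) (ribbon a) (@of_contract_flag H [set ribbon a]).
Proof. by move=> ra; rewrite -{2}(contract_flags1 ra); apply: contraction_contract. Qed.

(* These bounds say that the natural subtractions in nullity and in the exponent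
   of z are not truncated. *)
Lemma euler_bounds H :
  nb_vertices H + nb_closed_faces H <= #|edges H| + 2 * nb_components H /\
  nb_vertices H <= #|edges H| + nb_components H.
Proof.
have [n] := ubnP #|edges H|; elim: n => // n IHn in H *.
(* Without edges, vertices and components agree, and only isolated vertices have closed faces. *)
have [E0 _|[b]] := set_0Vmem (edges H).
  have rid (x : flag H) : rib x = x.
    by apply/eqP; apply: contraTT isT => rx; rewrite -edges_ribbon E0 inE in rx.
  have -> : nb_vertices H = nb_components H.
    rewrite nb_verticesE nb_componentsE; congr (#|pred_of_set _| + _).
    apply: eq_classes; apply: sub_connect_eq => x y.
      by rewrite step2E => xy; apply: connect1; rewrite step3E orbA xy.
    rewrite step3E rid orbA => /orP[xy|/eqP->]; last exact: connect0.
    by apply: connect1; rewrite step2E.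
  have -> : nb_closed_faces H = isolated H.
    rewrite /nb_closed_faces (_ : closed_faces H = set0) ?cards0 //.
    apply/setP=> f; rewrite !inE; apply/negbTE/negP=> /andP[/imsetP[x _ ->]].
    by move/forall_inP/(_ x); rewrite inE connect0 rid eqxx => /(_ isT).
  by rewrite E0 cards0 nb_componentsE; lia.
case/imsetP=> a; rewrite inE => ra _ En.
have ct := contraction_contract1 ra; pose K := contract [set ribbon a].
have Ee : #|edges H| = #|edges K|.+1 := card_edges_edge_contraction ct.
have EF : nb_closed_faces K = nb_closed_faces H := nb_closed_faces_contraction ct.
have [|E1 E2] := IHn K; first by lia.
(* Writing V, E, F, k for the numbers of vertices, edges, closed faces and components, neither V + F
   - E - 2k nor V - E - k decreases when an edge is contracted. *)
have := edge_counts ra ct; rewrite -/K.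
by case=> [[_ EV EK]|[_ _ EV EK]|[_ _ EV EK]]; lia.
Qed.

Section Compare.
Variables (H : herg) (a : flag H).
Hypothesis ra : rib a != a.
Local Notation e := (ribbon a).
Local Notation K := (contract [set e]).
Variables (S : {set {set flag H}}) (S' : {set {set flag K}}).
Hypotheses (aS : e \notin S)
  (SE : forall x : flag K, (ribbon x \in S') = (ribbon (of_contract_flag x) \in S)).
Local Notation A := (cut S).
Local Notation A' := (cut S').

Let ct : @contraction A A' (@ribbon A a) (@of_contract_flag H [set e]).
Proof.
rewrite ribbon_cut //; apply: contraction_cut (contraction_contract1 ra) _ SE => x.
by rewrite mem_ribbon => /eqP->.
Qed.

Let raA : @rib A a != a. Proof. by rewrite cut_ribE. Qed.

Lemma cut_contract_counts :
  [\/ [/\ connect (vertex_off a) a (seg a), nb_vertices A = (nb_vertices A').+1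
        & nb_components A' = nb_components A],
      [/\ ~~ connect (vertex_off a) a (seg a), connect (vertex_off a) a (rib a),
          nb_vertices A' = (nb_vertices A).+1
        & nb_components A' = nb_components A + ~~ connect (@component_off A a) a (seg a)]
    | [/\ ~~ connect (vertex_off a) a (seg a), ~~ connect (vertex_off a) a (rib a),
          nb_vertices A' = nb_vertices A & nb_components A' = nb_components A]].
Proof.
by have := edge_counts raA ct; rewrite !vertex_off_cut // cut_ribE.
Qed.

Lemma cut_contract_invariants :
  [/\ #|edges A| = #|edges A'|.+1, nb_closed_faces A' = nb_closed_faces A,
      nb_boundary_components A' = nb_boundary_components A & #|hrs A'| = #|hrs A|].
Proof.
split.
- exact: card_edges_edge_contraction ct.
- exact: nb_closed_faces_contraction ct.
- exact: nb_boundary_components_contraction ct.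
- exact: card_hrs_contraction ct.
Qed.

Lemma orientable_cut_contract_nonloop :
  connect (vertex_off a) a (seg a) -> orientable A' = orientable A.
Proof.
move=> ab; apply: (orientable_nonloop raA ct).
by rewrite (loop_pairing raA) vertex_off_cut // ab.
Qed.

Lemma orientable_cut_contract_separating :
  connect (vertex_off a) a (rib a) -> ~~ connect (@component_off A a) a (seg a) ->
  orientable A' = orientable A.
Proof.
move=> ac; apply: (orientable_separating raA ct).
by rewrite vertex_off_cut // cut_ribE.
Qed.

End Compare.

(** * Trivial loops *)

Section SwappedVertices.
Variable H : herg.
Implicit Types (x y a : flag H) (E : {set flag H}).

(* The classes of this relation are the vertices of the contraction of the
   edges with flags in E. *)
Definition swapped E := step [:: mix E rib (@seg H); arc].

Definition edge_flags E :=
  [/\ forall x, (rib x \in E) = (x \in E), forall x, (seg x \in E) = (x \in E)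
    & forall x, x \in E -> rib x != x].

Lemma edge_flags_ribbon a : rib a != a -> edge_flags (ribbon a).
Proof.
move=> ra; split=> x; rewrite ?ribbon_closed_rib ?ribbon_closed_seg //.
by move/rib_neq_ribbon->.
Qed.

Lemma edge_flagsU E E' : edge_flags E -> edge_flags E' -> edge_flags (E :|: E').
Proof.
move=> [r s n] [r' s' n']; split=> x; rewrite !inE ?r ?r' ?s ?s' //.
by case/orP=> [/n|/n'].
Qed.

Lemma swapK E : edge_flags E -> involutive (mix E rib (@seg H)).
Proof. by case=> r s _; apply: mixK => //; [exact: ribK | exact: segK]. Qed.

Lemma swap_neq E x : edge_flags E -> mix E rib (@seg H) x != x.
Proof. by case=> _ _ n; rewrite /mix; case: ifP => [/n|_] //; apply: seg_neq. Qed.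

Lemma swapped_sym E : edge_flags E -> connect_sym (swapped E).
Proof. by move/swapK=> sK; apply/sym_connect_sym/step2_sym => //; exact: arcK. Qed.

(** Only an untwisted loop lets contraction separate the ends of a segment; in the other two
    pairings they stay joined. The sides then join only flags which the arcs already join. *)
Lemma ends_swapped a : rib a != a -> ~~ connect (swapped (ribbon a)) a (seg a) ->
  [/\ connect (vertex_off a) a (rib a), connect (vertex_off a) (seg a) (seg (rib a)),
      ~~ connect (vertex_off a) a (seg a)
    & connect (swapped (ribbon a)) =2 connect (vertex_off a)].
Proof.
move=> ra nab; have ogK : involutive (mix (ribbon a) id (@seg H)).
  by apply: mixK => //; [exact: segK | exact: ribbon_closed_seg].
have sy : ssrbool.symmetric (vertex_off a) := step2_sym ogK (@arcK H).
have sw := connect_swap (@ribK H) erefl (rib_seg a) sy.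
have E : connect (swapped (ribbon a)) =2
    connect (link (link (vertex_off a) a (rib a)) (seg a) (seg (rib a))) by move=> x y; apply: sw.
have sl := sym_connect_sym (link_symmetric (seg a) (seg (rib a)) (link_symmetric a (rib a) sy)).
rewrite E in nab; case: (ribbon_pairing ra) => [[ab]|[ac bd nab']|[ad bc _ _]].
- by case/negP: nab; do 2 apply: sub_link.
- split=> // x y; rewrite E.
  have sl1 := sym_connect_sym (link_symmetric a (rib a) sy).
  rewrite (connect_link_id sl1 (sub_link _ _ bd)).
  by rewrite (connect_link_id (sym_connect_sym sy) ac).
case/negP: nab; apply: (connect_trans (y := rib a)); first exact/sub_link/connect_link_l.
by rewrite sl; do 2 apply: sub_link.
Qed.

(** Once [E] is contracted, the ribbon of [x] has its ends at two vertices, and contracting it glues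
    these discs together without splitting any. This is [rectangle_pairing] with the swapped
    segments in the role of [seg]. *)
Lemma swapped_merge E x : edge_flags E -> x \notin E -> rib x != x ->
  ~~ connect (swapped E) x (rib x) ->
  subrel (connect (swapped E)) (connect (swapped (E :|: ribbon x))) /\
  connect (swapped (E :|: ribbon x)) x (rib x).
Proof.
move=> eE xE rx nxr; have [Er Es En] := eE; have gK := swapK eE.
pose g := mix E rib (@seg H).
have gx : g x = seg x by rewrite /g /mix (negbTE xE).
have grx : g (rib x) = seg (rib x) by rewrite /g /mix Er (negbTE xE).
have gneq y : g y != y by apply: swap_neq.
have := rectangle_pairing (@arcK H) gK (@arc_neq H) gneq gx grx (uniq_ribbon rx).
have ogK : involutive (mix (ribbon x) id g).
  apply: mixK => // y; rewrite /g /mix.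
  by case: ifP => _; rewrite ?ribbon_closed_rib ?ribbon_closed_seg.
have sy : ssrbool.symmetric (step [:: mix (ribbon x) id g; arc]) := step2_sym ogK (@arcK H).
have gE := connect_g gK gx grx sy.
have := connect_swap (@ribK H) erefl (rib_seg x) sy.
rewrite -/(ribbon x); set B := step [:: mix (ribbon x) id g; arc] => swE.
have gE' : connect (swapped E) =2 connect (link (link B x (seg x)) (rib x) (seg (rib x))).
  by move=> u v; rewrite /swapped gE.
have swE' : connect (swapped (E :|: ribbon x)) =2 connect (link (link B x (rib x)) (seg x) (seg (rib x))).
  move=> u v; rewrite -swE; apply: eq_connect => {}u {}v; rewrite /swapped !step2E /mix !inE.
  by rewrite /g /mix -!orbA; case: (u \in E) => //=; case: ifP.
have sl := sym_connect_sym (link_symmetric (rib x) (seg (rib x)) (link_symmetric x (seg x) sy)).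
rewrite gE' in nxr.
case=> [[ab cd _]|[ac _ _]|[ad bc _ _]].
- split=> [u v|]; last by rewrite swE'; apply/sub_link/connect_link_l.
  rewrite gE' swE' => uv; do 2 apply: sub_link; move: uv.
  have sl1 := sym_connect_sym (link_symmetric x (seg x) sy).
  by rewrite (connect_link_id sl1 (sub_link _ _ cd)) (connect_link_id (sym_connect_sym sy) ab).
- by case/negP: nxr; do 2 apply: sub_link.
case/negP: nxr; apply: (connect_trans (y := seg (rib x))); first by do 2 apply: sub_link.
by rewrite sl; apply: connect_link_l.
Qed.

Lemma swapped_untouched E E' u w : E \subset E' ->
  (forall y, connect (swapped E) u y -> y \in E' -> y \in E) ->
  connect (swapped E') u w = connect (swapped E) u w.
Proof.
move=> /subsetP sE un; have := @sub_class_eq _ (eqclass (swapped E) u) (swapped E) (swapped E') u.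
move=> /(_ _ (subxx _)) H0; have /setP/(_ w) : eqclass (swapped E') u = eqclass (swapped E) u.
  apply: H0 => y z; rewrite inE => uy; rewrite /swapped !step2E /mix.
  have -> // : (y \in E') = (y \in E).
  by apply/idP/idP => [/(un _ uy)|/sE].
by rewrite !inE.
Qed.

End SwappedVertices.

Section Alternate.
Variables (K : herg) (a x : flag K).
Hypotheses (ra : rib a != a) (nab : ~~ connect (swapped (ribbon a)) a (seg a)).
Hypotheses (ax : connect (swapped (ribbon a)) a x)
  (bx : connect (swapped (ribbon a)) (seg a) (rib x)) (xa : x \notin ribbon a).
Local Notation D := (ribbon a).
Local Notation phi := (@next_segment K).

Let g := mix D id (@seg K).
Let gK : involutive g.
Proof. by apply: mixK => //; [exact: segK | exact: ribbon_closed_seg]. Qed.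
Let gD y : y \in D -> g y = y. Proof. by rewrite /g /mix => ->. Qed.
Let gnD y : g y != y -> y \notin D.
Proof. by apply: contra => /gD->. Qed.

(* If contracting ribbon a puts the two ends of ribbon x at different vertices,
   then each end lies on its own boundary arc between the ends of ribbon a. *)
Lemma alternate_separated : alternate (ribbon a) (ribbon x).
Proof.
have [ac bd _ QE] := ends_swapped ra nab.
have := bx; have := ax; rewrite !QE => ax' bx'.
have stepE : connect (vertex_off a) =2 connect (step [:: arc; g]).
  by apply: eq_connect => u v; rewrite /vertex_off !step2E orbC.
have sy : connect_sym (vertex_off a) := sym_connect_sym (step2_sym gK (@arcK K)).
have [aD bD cD dD] : [/\ a \in D, seg a \in D, rib a \in D & seg (rib a) \in D].
  by rewrite !inE !eqxx !orbT.
(* [next_segment] applies [seg] before [arc], whereas a walk begins with [arc]; hence the start at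
   [seg z] and the shift by one. *)
have walkE z m i : (forall i, i < m -> g (walk arc g i z) != walk arc g i z) -> i <= m ->
    walk arc g i z = iter i.+1 phi (seg z).
  move=> wi; elim: i => [|i IHi] im; first by rewrite /walk /= /next_segment segK.
  rewrite iterS -IHi 1?ltnW // /walk iterS -/(walk _ _ _ _) /next_segment; congr arc.
  by rewrite /g /mix (negbTE (gnD (wi _ im))).
have onwalk z y m : (forall i, i < m -> g (walk arc g i z) != walk arc g i z) ->
    g z = z -> g (walk arc g m z) = walk arc g m z ->
    walk arc g m z \in D -> z \in D -> y \notin D -> connect (vertex_off a) z y ->
    exists2 i, i < m & walk arc g i z \in ribbon y.
  move=> wi gz gm mD zD yD; rewrite stepE => /(walk_setP (@arcK K) gK gz gm)[E|E|[i im]].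
  - by rewrite E zD in yD.
  - by rewrite E mD in yD.
  case/orP=> /eqP E; exists i => //; first by rewrite -E !inE eqxx.
  move: E; rewrite /g /mix (negbTE (gnD (wi _ im))) => ->.
  by rewrite ribbon_seg !inE eqxx.
have [m1 [w1 g1 i1]] := walk_end (@arcK K) gK (@arc_neq K) (gD aD).
have [m2 [w2 g2 i2]] := walk_end (@arcK K) gK (@arc_neq K) (gD dD).
rewrite !stepE in ac bd.
have E1 : walk arc g m1 a = rib a.
  by apply/esym/(walk_fixed_unique (@arcK K) gK (gD aD) g1 i1 ac (gD cD)); rewrite ra.
have E2 : walk arc g m2 (seg (rib a)) = seg a.
  apply/esym/(walk_fixed_unique (@arcK K) gK (gD dD) g2 i2 _ (gD bD)).
    by rewrite -stepE sy stepE.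
  by rewrite (inj_eq (can_inj (@segK K))) eq_sym.
have xD' : rib x \notin D by rewrite ribbon_closed_rib.
have [i im1 ix] := onwalk a x m1 i1 (gD aD) g1 (etrans (f_equal (fun y => y \in D) E1) cD) aD xa ax'.
have [j jm2] : exists2 j, j < m2 & walk arc g j (seg (rib a)) \in ribbon (rib x).
  apply: (onwalk _ _ _ i2 (gD dD) g2 _ dD xD'); first by rewrite E2.
  by apply: connect_trans bx'; rewrite sy stepE.
rewrite ribbon_rib => jx.
rewrite (walkE _ _ _ i1) 1?ltnW // in ix.
rewrite (walkE _ _ _ i2) 1?ltnW // segK in jx.
have phi1 : iter m1.+1 phi (seg a) = rib a by rewrite -(walkE _ _ _ i1).
have phi2 : iter m2.+1 phi (rib a) = seg a by rewrite -E2 (walkE _ _ _ i2) // segK.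
(* From [seg a], [m1.+1] turns follow the arc from [a] to [rib a], and [m2.+1] more follow the arc
   from [seg (rib a)] back to [seg a]. The two ends of [ribbon x] are met inside the first and
   inside the second arc. *)
exists (seg a), i.+1, m1.+1, (j.+1 + m1.+1); split=> //.
(* An earlier return to [seg a] would take place strictly inside one of the two arcs, where no flag
   is in [D], or at [rib a]. *)
- rewrite addSn ltnS leq_addl /=; rewrite ltnNge; apply/negP=> le.
  have inj : injective phi by apply: inj_comp; [exact: can_inj (@arcK K)|exact: can_inj (@segK K)].
  have := iter_order inj (seg a); have := order_gt0 phi (seg a).
  case: (order phi (seg a)) le => // o le _ E.
  case: (ltngtP o m1) => om.
  + move: (i1 o om); rewrite (walkE _ _ _ i1) 1?ltnW // E.
    by rewrite (gD bD) eqxx.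
  + have oE : o.+1 = (o - m1.+1).+1 + m1.+1 by rewrite addSn subnK.
    rewrite oE iterD phi1 in E.
    have lt : o - m1.+1 < m2.
      by rewrite -(ltn_add2r m1.+1) subnK // (leq_trans le) // -addSn leq_add2r.
    move: (i2 _ lt); rewrite (walkE _ _ _ i2) 1?ltnW // segK E.
    by rewrite (gD bD) eqxx.
  + move: phi1; rewrite -om E => /eqP; apply/negP.
    by rewrite eq_sym rib_neq_seg.
by rewrite iterD phi1.
Qed.

End Alternate.

Lemma connect_homo (T T' : finType) (e : rel T) (e' : rel T') (h : T -> T') :
  (forall x y, e x y -> connect e' (h x) (h y)) ->
  forall x y, connect e x y -> connect e' (h x) (h y).
Proof.
move=> he x y xy; pose P := [pred y | connect e' (h x) (h y)].
apply: (connect_invariant (A := mem P) _ _ xy); last exact: connect0.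
by move=> u v xu uv; apply: connect_trans xu (he _ _ uv).
Qed.

(* If e is an untwisted loop whose two boundary arcs remain connected off e,
   a shortest way between these arcs is a cycle showing that e is not trivial. *)
Section Path.
Variables (H : herg) (a : flag H).
Hypothesis ra : rib a != a.
Hypothesis nab : ~~ connect (swapped (ribbon a)) a (seg a).
Hypothesis cab : connect (component_off a) a (seg a).
Local Notation E0 := (ribbon a).
Local Notation cl := (eqclass (swapped E0)).

Let eE0 : edge_flags E0 := edge_flags_ribbon ra.
Let sy : connect_sym (swapped E0) := swapped_sym eE0.

(** The underlying graph after contraction of [ribbon a], its vertices being given as classes of
    flags of [H]. *)
Definition class_adj : rel {set flag H} := fun V W =>
  [exists x in V, [&& x \notin E0, rib x != x & cl (rib x) == W]].

Lemma class_adj_connect : connect class_adj (cl a) (cl (seg a)).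
Proof.
apply: (connect_homo (h := fun x => cl x) _ cab) => x y.
rewrite /component_off step3E /mix => /or3P[]/eqP->.
- have [xE|xE] := boolP (x \in E0); first exact: connect0.
  suff -> : cl (seg x) = cl x by apply: connect0.
  apply/eqP; rewrite eqclass_eq // sy; apply: connect1.
  by rewrite /swapped step2E /mix (negbTE xE) eqxx.
- suff -> : cl (arc x) = cl x by apply: connect0.
  by apply/eqP; rewrite eqclass_eq // sy; apply: connect1; rewrite /swapped step2E eqxx orbT.
have [xE|xE] := boolP (x \in E0); first exact: connect0.
have [->|rx] := eqVneq (rib x) x; first exact: connect0.
apply: connect1; apply/exists_inP; exists x; first by rewrite inE connect0.
by rewrite xE rx eqxx.
Qed.

Lemma class_path : exists (s : seq (flag H)) (L : nat -> {set flag H}),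
  [/\ forall i, i < size s -> nth a s i \notin E0 /\ rib (nth a s i) != nth a s i,
      forall i, i < size s -> cl (nth a s i) = L i /\ cl (rib (nth a s i)) = L i.+1,
      L 0 = cl a, L (size s) = cl (seg a)
    & forall i j, i <= size s -> j <= size s -> L i = L j -> i = j].
Proof.
have [p pp pl] := connectP class_adj_connect.
(* Shortening makes the vertices of the path distinct; the injectivity of [L] comes from here. *)
case: (shortenP pp) pl => q qp qu _ ql {p pp}.
have [s ss sP] : exists2 s, size s = size q & forall i, i < size q ->
   [/\ nth a s i \notin E0, rib (nth a s i) != nth a s i,
    cl (nth a s i) = nth set0 (cl a :: q) i & cl (rib (nth a s i)) = nth set0 (cl a :: q) i.+1].
  have : exists x, cl a = cl x by exists a.
  move: (cl a) qp {qu ql} => V; elim: q V => [|W q IHq] V /=; first by exists [::].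
  case/andP=> /exists_inP[x xV /and3P[xE rx /eqP xW]] qp [z Vz].
  have [|s ss sP] := IHq W qp; first by exists (rib x).
  exists (x :: s); rewrite /= ?ss // => -[|i] iq; last exact: sP.
  by split=> //; rewrite Vz; apply/eqP; rewrite eqclass_eq // sy; move: xV; rewrite Vz inE.
exists s, (nth set0 (cl a :: q)); rewrite ss; split=> //.
- by move=> i /sP[].
- by move=> i /sP[].
- by rewrite ql (last_nth set0).
by move=> i j iq jq /eqP; rewrite nth_uniq // => /eqP.
Qed.

End Path.

(* L i is the set of flags at the i-th vertex of the cycle, the vertex of the
   loop being split into the two vertices L 0 and L n of the contraction. *)
Section Cycle.
Variables (H : herg) (a : flag H).
Hypothesis ra : rib a != a.
Hypothesis nab : ~~ connect (swapped (ribbon a)) a (seg a).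
Local Notation E0 := (ribbon a).
Local Notation cl := (eqclass (swapped E0)).
Variables (s : seq (flag H)) (L : nat -> {set flag H}).
Local Notation n := (size s).
Local Notation f := (nth a s).
Hypotheses (sE : forall i, i < n -> f i \notin E0 /\ rib (f i) != f i)
  (sL : forall i, i < n -> cl (f i) = L i /\ cl (rib (f i)) = L i.+1)
  (L0 : L 0 = cl a) (Ln : L n = cl (seg a))
  (L_inj : forall i j, i <= n -> j <= n -> L i = L j -> i = j).

Let eE0 : edge_flags E0 := edge_flags_ribbon ra.
Let sy : connect_sym (swapped E0) := swapped_sym eE0.

Let n_gt0 : 0 < n.
Proof.
rewrite lt0n; apply: contra nab => /eqP n0; rewrite -eqclass_eq //.
by rewrite -L0 -Ln n0.
Qed.

Let cl_seg x : x \notin E0 -> cl (seg x) = cl x.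
Proof.
move=> xE; apply/eqP; rewrite eqclass_eq // sy; apply: connect1.
by rewrite /swapped step2E /mix (negbTE xE) eqxx.
Qed.

Let cl_arc x : cl (arc x) = cl x.
Proof. by apply/eqP; rewrite eqclass_eq // sy; apply: connect1; rewrite /swapped step2E eqxx orbT. Qed.

Let cl_rib x : x \in E0 -> cl (rib x) = cl x.
Proof.
move=> xE; apply/eqP; rewrite eqclass_eq // sy; apply: connect1.
by rewrite /swapped step2E /mix xE eqxx.
Qed.

Let cl_ribbon i y : i < n -> y \in ribbon (f i) -> cl y = L i \/ cl y = L i.+1.
Proof.
move=> i_n; have [fE _] := sE i_n; have [<- <-] := sL i_n.
rewrite !inE -!orbA => /or4P[]/eqP->; [by left | by left; rewrite cl_seg | by right |].
by right; rewrite cl_seg // ribbon_closed_rib.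
Qed.

(** The ends of the i-th edge lie in [L i] and [L i.+1]. If two different indices gave the same
    edge, each would be the successor of the other. *)
Lemma cycle_ribbon_inj i j : i < n -> j < n -> ribbon (f i) = ribbon (f j) -> i = j.
Proof.
move=> i_n j_n ij.
have [] : L j = L i \/ L j = L i.+1.
  by have [<- _] := sL j_n; apply: cl_ribbon => //; rewrite mem_ribbon ij.
  by move/(L_inj (ltnW j_n) (ltnW i_n)).
move/(L_inj (ltnW j_n) i_n) => ji.
have [] : L i = L j \/ L i = L j.+1.
  by have [<- _] := sL i_n; apply: cl_ribbon => //; rewrite mem_ribbon ij.
  by move/(L_inj (ltnW i_n) (ltnW j_n)).
by move/(L_inj (ltnW i_n) j_n) => ij'; lia.
Qed.

Let E0_cl x : x \in E0 -> cl x = cl a \/ cl x = cl (seg a).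
Proof.
have ca : cl (rib a) = cl a by apply: cl_rib; rewrite mem_ribbon.
have cb : cl (seg (rib a)) = cl (seg a).
  by rewrite -rib_seg; apply: cl_rib; rewrite ribbon_closed_seg mem_ribbon.
by rewrite !inE -!orbA => /or4P[]/eqP->; auto.
Qed.

Let vertex_cl x y : y \in vertex x ->
  cl x = cl y \/ (cl x = cl a \/ cl x = cl (seg a)) /\ (cl y = cl a \/ cl y = cl (seg a)).
Proof.
rewrite inE => xy.
pose P := [pred y | (cl x == cl y) || ((cl x == cl a) || (cl x == cl (seg a))) && ((cl y == cl a) || (cl y == cl (seg a)))].
suff: y \in P.
  rewrite inE => /orP[/eqP|/andP[A B]]; [by left | right].
  by split; [case/orP: A => /eqP; auto | case/orP: B => /eqP; auto].
apply: (connect_invariant (A := mem P) _ _ xy); last by rewrite inE eqxx.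
move=> u v uP uv; have : step [:: seg; arc] u v := uv; rewrite step2E.
case/orP=> /eqP->; last by rewrite inE cl_arc.
have [uE|uE] := boolP (u \in E0); last by rewrite inE cl_seg.
have uE' : seg u \in E0 by rewrite ribbon_closed_seg.
move: uP; rewrite !inE; case: (E0_cl uE) => ->; case: (E0_cl uE') => ->; rewrite !eqxx ?orbT ?andbT /=.
all: by case: (cl x == cl a); case: (cl x == cl (seg a)).
Qed.

(** Among the classes [L i], only [L 0] and [L n] can share a vertex of [H], as the two halves of
    the vertex of the loop; an index below [n] meets only the first of them. *)
Lemma cycle_vertex_inj i j : i < n -> j < n -> vertex (f i) = vertex (f j) -> i = j.
Proof.
move=> i_n j_n /setP/(_ (f j)); rewrite [RHS]inE connect0 => /vertex_cl.
have [-> _] := sL i_n; have [-> _] := sL j_n; rewrite -L0 -Ln.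
have z k : k < n -> L k = L 0 \/ L k = L n -> k = 0.
  move=> kn [/(L_inj (ltnW kn) (leq0n n)) // | /(L_inj (ltnW kn) (leqnn n)) E].
  by rewrite E ltnn in kn.
by case=> [/(L_inj (ltnW i_n) (ltnW j_n)) // | [/(z _ i_n)-> /(z _ j_n)->]].
Qed.

Let sub_vertex x y : cl x = cl y -> y \in vertex x.
Proof.
move/eqP; rewrite eqclass_eq // inE; have [_ _ _ ->] := ends_swapped ra nab.
apply: connect_sub => u v; rewrite /vertex_off step2E /mix => /orP[]/eqP->.
  by case: ifP => _; [apply: connect0 | apply: connect1; rewrite !inE eqxx].
by apply: connect1; rewrite !inE eqxx orbT.
Qed.

Lemma cycle_graph_cycle : graph_cycle s.
Proof.
apply/and4P; split.
- by apply/(all_nthP a) => i i_n; case: (sE i_n).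
- case Es: s => [//|x s'] /=; apply/(pathP a) => i; rewrite size_rcons => i_n.
  have En : n = (size s').+1 by rewrite Es.
  have fi : nth a (x :: rcons s' x) i = f i.
    by rewrite Es -rcons_cons nth_rcons /= i_n.
  rewrite fi nth_rcons; case: ltnP => [lt|ge].
    have -> : nth a s' i = f i.+1 by rewrite Es.
    apply: sub_vertex; have [|_ ->] := @sL i; first by rewrite En.
    by have [|-> _] := @sL i.+1; rewrite ?En.
  (* The last edge arrives in [L n], the class of [seg a], and the first leaves from [L 0], the
     class of [a]; in [H] the segment of the loop closes the cycle. *)
  have Ei : i = size s' by apply/eqP; rewrite eqn_leq ge -ltnS i_n.
  rewrite Ei eqxx; have [|_ rE] := @sL (size s'); first by rewrite En.
  rewrite -En Ln in rE; have -> : x = f 0 by rewrite Es.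
  have [|xE _] := @sL 0; first by rewrite En.
  rewrite L0 in xE.
  have vsy := sym_connect_sym (step2_sym (@segK H) (@arcK H)).
  have := sub_vertex rE; have := sub_vertex xE; rewrite !inE => xa rb.
  apply: (connect_trans (y := seg a)); first exact: rb.
  apply: (connect_trans (y := a)); last by have := vsy (f 0) a; rewrite /step => <-.
  by apply: connect1; rewrite !inE segK eqxx.
- apply/(uniqP set0) => i j; rewrite !inE size_map => i_n j_n.
  by rewrite !(nth_map a) //; apply: cycle_vertex_inj.
apply/(uniqP set0) => i j; rewrite !inE size_map => i_n j_n.
by rewrite !(nth_map a) //; apply: cycle_ribbon_inj.
Qed.


Let x0 := f 0.
Let s' := behead s.
Let sE' : s = x0 :: s'.
Proof. by rewrite /x0 /s'; case: s n_gt0. Qed.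

Let fS i : nth a s' i = f i.+1. Proof. by rewrite sE'. Qed.

Definition flags_of (l : seq (flag H)) : {set flag H} := [set y | ribbon y \in [seq ribbon x | x <- l]].

(** The edge of [x0] is left out, since it is to become the loop that alternates with [ribbon a]. *)
Let E j := E0 :|: flags_of (take j s').

Let size_s' : size s' = n.-1. Proof. by rewrite sE'. Qed.

Let mem_E j y : y \in E j -> y \notin E0 -> exists i, [/\ 0 < i <= j, i < n & y \in ribbon (f i)].
Proof.
rewrite inE => /orP[-> //|]; rewrite inE => /mapP[x /(nthP a)[i]].
rewrite size_take_min leq_min => /andP[ij i_s] <-; rewrite nth_take // fS => yE _.
exists i.+1; rewrite mem_ribbon yE eqxx; split=> //.
by rewrite sE'.
Qed.

Let eE j : edge_flags (E j).
Proof.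
apply: edge_flagsU => //; split=> x; rewrite ?inE ?ribbon_rib ?ribbon_seg //.
case/mapP=> y /(nthP a)[i]; rewrite size_take_min leq_min => /andP[ij i_s] <-.
rewrite nth_take // fS => xy; have : x \in ribbon (f i.+1) by rewrite mem_ribbon xy.
move/rib_neq_ribbon->; have [|_ //] := @sE i.+1.
by rewrite sE'.
Qed.

(** The edges [f 1] to [f j] are attached at [L 1] to [L j.+1] only. *)
Let untouched j i u w : j < n -> i <= n -> cl u = L i -> i = 0 \/ j.+1 < i ->
  connect (swapped (E j)) u w = connect (swapped E0) u w.
Proof.
move=> j_n i_n uL ij; apply: swapped_untouched; first exact: subsetUl.
move=> y uy yE; apply: contraT => yE0.
have [k [/andP[k0 kj] kn yk]] := mem_E yE yE0.
have yL : cl y = L i by rewrite -uL; apply/eqP; rewrite eqclass_eq // sy.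
case: (cl_ribbon kn yk); rewrite yL.
  by move/(L_inj i_n (ltnW kn)) => ik; case: ij; lia.
by move/(L_inj i_n kn) => ik; case: ij; lia.
Qed.

Let E_S j : j < size s' -> E j.+1 = E j :|: ribbon (f j.+1).
Proof.
move=> js; rewrite /E (take_nth a) // fS -setUA; congr (_ :|: _).
by apply/setP=> y; rewrite !inE map_rcons mem_rcons inE orbC -mem_ribbon !inE.
Qed.

(** The edge [f j.+1] goes from the vertex merged so far, which contains [rib x0], to the intact
    [L j.+2]. It is thus not a loop when its turn comes, and contracting it absorbs [L j.+2]. *)
Lemma cycle_chain j : j < n -> forall i u, 0 < i <= j.+1 -> cl u = L i ->
  connect (swapped (E j)) (rib x0) u.
Proof.
have [_ rx0] := sL n_gt0.
elim: j => [|j IHj] j_n i u /andP[i0 ij] uL.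
  have -> : E 0 = E0 by apply/setP=> y; rewrite /E take0 !inE orbF.
  by rewrite -eqclass_eq // rx0 uL; apply/eqP; congr L; lia.
have IH := IHj (ltnW j_n); pose x := f j.+1.
have [xL rxL] := sL j_n; have [xE rx] := sE j_n.
have js : j < size s' by rewrite size_s'; lia.
have xEj : x \notin E j.
  apply/negP=> /mem_E/(_ xE)[k [/andP[_ kj] kn]].
  by rewrite mem_ribbon => /eqP/(cycle_ribbon_inj j_n kn) ?; lia.
have nx : ~~ connect (swapped (E j)) x (rib x).
  rewrite (swapped_sym (eE j)) (@untouched j j.+2) //; [|exact: ltnW|by right].
  rewrite -eqclass_eq // xL rxL; apply/eqP.
  by move/(L_inj j_n (ltnW j_n)); lia.
have [sub xrx] := swapped_merge (eE j) xEj rx nx.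
rewrite E_S //; have x0x := sub _ _ (IH j.+1 x _ xL).
have [ij'|ij'] := leqP i j.+1; first by apply: sub; apply: (IH i); rewrite ?i0.
have {ij ij'} iE : i = j.+2 by lia.
apply: connect_trans (x0x _) (connect_trans xrx (sub _ _ _)); first by rewrite /= leqnn.
rewrite (@untouched j j.+2) //; [|exact: ltnW|by right].
by rewrite -eqclass_eq // uL rxL iE.
Qed.

Let S : {set {set flag H}} := [set:: [seq ribbon y | y <- s']].

Let EE : E n.-1 = E0 :|: contract_flags S.
Proof.
rewrite /E -size_s' take_size; congr (_ :|: _); apply/setP=> y; rewrite !inE.
case: (boolP (_ \in _)) => //= /mapP[x /(nthP a)[i i_s <-]]; rewrite fS => yx.
have : y \in ribbon (f i.+1) by rewrite mem_ribbon yx.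
move/rib_neq_ribbon->; have [|_ ->] //:= @sE i.+1.
by rewrite sE'.
Qed.

(** Contracting [ribbon a] in [contract S] gives the same vertices as contracting it together with
    [S] ([QE]). There [a] and [x0] share the intact vertex [L 0], while [seg a] and [rib x0] share
    the vertex merged from all the others, so [alternate_separated] applies. *)
Lemma cycle_alternate :
  @alternate (contract S) [set y | of_contract_flag y \in ribbon a]
                          [set y | of_contract_flag y \in ribbon x0].
Proof.
have n1 : n.-1 < n by rewrite prednK.
have nS x : x \in s' -> x \notin E0.
  by case/(nthP a) => i i_s <-; rewrite fS; have [] // := @sE i.+1; rewrite sE'.
have aS : a \notin contract_flags S.
  rewrite !inE; apply/negP=> /andP[/mapP[x xs ax] _].
  by move: (nS x xs); rewrite mem_ribbon -ax eqxx.
have xS : x0 \notin contract_flags S.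
  rewrite !inE; apply/negP=> /andP[/mapP[x /(nthP a)[i i_s <-]] + _].
  rewrite fS => /cycle_ribbon_inj inj0; have : 0 = i.+1 by apply: inj0; rewrite // sE'.
  by [].
pose a' : flag (contract S) := Sub a aS.
pose x' : flag (contract S) := Sub x0 xS.
pose K := contract S; have ct := contraction_contract S.
have ribE (y' : flag K) : [set y | of_contract_flag y \in ribbon (of_contract_flag y')] = ribbon y'.
  by apply/setP=> y; rewrite inE (ribbon_contraction ct) mem_imset //; apply: io_inj ct.
rewrite -[a]/(of_contract_flag a') -[x0]/(of_contract_flag x') !ribE.
have memE (y : flag K) : (of_contract_flag y \in E n.-1) = (y \in ribbon a').
  by rewrite EE inE (negbTE (io_notin ct y)) orbF -[E0]/(ribbon (of_contract_flag a'))
    (ribbon_contraction ct) mem_imset //; apply: io_inj ct.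
have QE y z : connect (swapped (E n.-1)) (of_contract_flag y) (of_contract_flag z) =
    connect (@swapped K (ribbon a')) y z.
  apply: (connect_contraction ct
    (r := [rel u v | v == mix (E n.-1) rib seg u])
    (r' := [rel u v | v == mix (ribbon a') rib seg u])) => [u v|u w|u w|u|u v|u v] /=.
  - by move/eqP->; rewrite /mix memE; case: ifP.
  - by move/eqP->; rewrite /mix memE; exists (mix (ribbon a') rib seg u); rewrite /mix //; case: ifP.
  - by move=> uD /eqP->; left; rewrite /mix EE inE uD orbT.
  - by move=> uD; rewrite /mix EE inE uD orbT.
  - by rewrite /swapped step2E orbC.
  - by rewrite /swapped step2E orbC.
have [x0L _] := sL n_gt0; have [x0E rx0] := sE n_gt0.
apply: alternate_separated.
- by rewrite -(inj_eq (io_inj ct)) (io_rib ct).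
- by rewrite -QE (io_seg ct) (@untouched _ 0) //; by left.
- by rewrite -QE (@untouched _ 0) //; [rewrite -eqclass_eq // -L0 -x0L | left].
- rewrite -QE (io_seg ct) (io_rib ct) (swapped_sym (eE _)).
  by apply: (cycle_chain n1 (i := n)); rewrite ?n_gt0 ?prednK //= -?Ln.
by rewrite -memE EE inE negb_or x0E xS.
Qed.

Lemma cycle_not_trivial : ~ trivial_loop (ribbon a).
Proof.
case=> _; apply; exists x0, s'; split; first by rewrite -sE'; apply: cycle_graph_cycle.
exact: cycle_alternate.
Qed.

End Cycle.

Lemma trivial_loop_separating (H : herg) (a : flag H) : rib a != a ->
  trivial_loop (ribbon a) -> connect (vertex_off a) a (rib a) ->
  ~~ connect (component_off a) a (seg a).
Proof.
move=> ra tr ac; apply/negP=> cab.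
have [lp _] := tr.
have nab : ~~ connect (swapped (ribbon a)) a (seg a).
  have nab : ~~ connect (vertex_off a) a (seg a) by rewrite -loop_pairing.
  have bd : connect (vertex_off a) (seg a) (seg (rib a)).
    by case: (ribbon_pairing ra) => [[_ _]|[]|[_ _ _]] //; rewrite ac.
  have ogK : involutive (mix (ribbon a) id (@seg H)).
    by apply: mixK => //; [exact: segK | exact: ribbon_closed_seg].
  have sy : ssrbool.symmetric (vertex_off a) := step2_sym ogK (@arcK H).
  have -> := connect_swap (@ribK H) erefl (rib_seg a) sy a (seg a).
  rewrite -/(vertex_off a).
  have sl := sym_connect_sym (link_symmetric a (rib a) sy).
  by rewrite (connect_link_id sl (sub_link _ _ bd)) (connect_link_id (sym_connect_sym sy) ac).
have [s [L [sE sL L0 Ln L_inj]]] := class_path ra cab.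
exact: (cycle_not_trivial ra nab sE sL L0 Ln L_inj tr).
Qed.

(** * Terms of the polynomial *)

Local Open Scope ring_scope.


Lemma twisted_orientable_term (R : comNzRingType) (x Y y Z z s W t : R) :
  x * (Y * y) * (Z * z) * s * W * t - Y * Z * W * (x * y * z * s * 1 * t) =
  0 * (W ^+ 2 - W).
Proof. ring. Qed.

(** If the contracted surface is not orientable either, the factor w of the relation meets the w of
    its term, giving w^2 against w on the other side. *)
Lemma twisted_term (R : comNzRingType) (x Y y Z z s W t : R) :
  x * (Y * y) * (Z * z) * s * W * t - Y * Z * W * (x * y * z * s * W * t) =
  - (x * (Y * y) * (Z * z) * s * t) * (W ^+ 2 - W).
Proof. ring. Qed.

Section Terms.
Variables (H : herg) (a : flag H).
Hypothesis ra : rib a != a.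
Local Notation e := (ribbon a).
Local Notation K := (contract [set e]).

Variables (S : {set {set flag H}}) (S' : {set {set flag K}}).
Hypotheses (aS : e \notin S)
  (SE : forall x : flag K, (ribbon x \in S') = (ribbon (of_contract_flag x) \in S)).
Local Notation A := (cut S).
Local Notation A' := (cut S').

(** [H] and [A] lose one vertex alike, so the difference of their ranks stays; the nullity stays
    because an edge is lost as well. *)
Lemma br_term_nonloop : connect (vertex_off a) a (seg a) ->
  br_term H A = br_term K A'.
Proof.
move=> ab; rewrite /br_term (orientable_cut_contract_nonloop ra aS SE ab).
have [Ee -> -> ->] := cut_contract_invariants ra aS SE.
have := edge_counts ra (contraction_contract1 ra); rewrite ab; case=> [[_ VH KH]|[//]|[//]].
have := cut_contract_counts ra aS SE; rewrite ab; case=> [[_ VA KA]|[//]|[//]].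
have le1 := nb_components_le_vertices A'; have le2 := nb_components_le_vertices K.
have -> : (rank H - rank A = rank K - rank A')%N by rewrite /rank; lia.
have -> : nullity A = nullity A' by rewrite /nullity; lia.
by rewrite KA.
Qed.

(** Contraction adds a vertex and, the loop being separating, a component. The rank stays, the
    nullity drops by one, and the exponent of z stays because the changes of k and n cancel. *)
Lemma br_term_untwisted :
  ~~ connect (vertex_off a) a (seg a) -> connect (vertex_off a) a (rib a) ->
  ~~ connect (component_off a) a (seg a) ->
  br_term H A = (Y_ - 1) * br_term K A'.
Proof.
move=> nab ac nc; have ncA : ~~ connect (@component_off A a) a (seg a).
  by apply: contra nc; apply: component_off_cut.
rewrite /br_term (orientable_cut_contract_separating ra aS SE ac ncA).
have [Ee -> -> ->] := cut_contract_invariants ra aS SE.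
have := edge_counts ra (contraction_contract1 ra); rewrite (negbTE nab) ac nc; case=> [[//]|[_ _ VH KH]|[//]].
have := cut_contract_counts ra aS SE; rewrite (negbTE nab) ac ncA.
case=> [[//]|[_ _ VA KA]|[//]].
have [_ le] := euler_bounds A'.
have -> : (rank H - rank A = rank K - rank A')%N by rewrite /rank; lia.
have -> : nullity A = (nullity A').+1 by rewrite /nullity; lia.
have -> : (nb_components A + (nullity A').+1 - nb_closed_faces A =
  nb_components A' + nullity A' - nb_closed_faces A)%N by lia.
by rewrite exprS (mulrCA ((X_ - 1) ^+ _)) -!mulrA.
Qed.

Lemma eq_modW_refl (P : {mpoly int[6]}) : P =w P.
Proof. by exists 0; rewrite subrr mul0r. Qed.

Lemma eq_modW_add (P P' Q Q' : {mpoly int[6]}) : P =w P' -> Q =w Q' -> P + Q =w P' + Q'.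
Proof.
by case=> U EU [V EV]; exists (U + V); rewrite mulrDl -EU -EV opprD addrACA.
Qed.

(** Vertices and components stay while one edge goes, so the nullity and the exponent of z both drop
    by one; [euler_bounds] ensures that no truncation hides this. [A] is not orientable, whence the
    factor w. *)
Lemma br_term_twisted :
  ~~ connect (vertex_off a) a (seg a) -> ~~ connect (vertex_off a) a (rib a) ->
  br_term H A =w (Y_ - 1) * Z_ * W_ * br_term K A'.
Proof.
move=> nab nac; have raA : @rib A a != a by rewrite cut_ribE.
have oA : ~~ orientable A.
  apply: (twisted_not_orientable raA); last by rewrite vertex_off_cut // cut_ribE.
  by rewrite (loop_pairing raA) vertex_off_cut.
rewrite /br_term oA.
have [Ee EF -> ->] := cut_contract_invariants ra aS SE; rewrite EF.
have := edge_counts ra (contraction_contract1 ra); rewrite (negbTE nab) (negbTE nac); case=> [[//]|[//]|[_ _ VH KH]].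
have := cut_contract_counts ra aS SE; rewrite (negbTE nab) (negbTE nac).
case=> [[//]|[//]|[_ _ VA KA]].
have [le1 le2] := euler_bounds A'; rewrite EF in le1.
have -> : (rank H - rank A = rank K - rank A')%N by rewrite /rank; lia.
have -> : nullity A = (nullity A').+1 by rewrite /nullity; lia.
have -> : (nb_components A + (nullity A').+1 - nb_closed_faces A =
  (nb_components A' + nullity A' - nb_closed_faces A).+1)%N by rewrite /nullity; lia.
rewrite !exprS; set x := (X_ - 1) ^+ _; set y := (Y_ - 1) ^+ _.
set z := Z_ ^+ _; set s := S_ ^+ _; set t := T_ ^+ _.
case: (orientable A') => /=.
  by rewrite !expr0 mulr1; exists 0; apply: twisted_orientable_term.
rewrite expr0 mulr1 expr1; exists (- (x * ((Y_ - 1) * y) * (Z_ * z) * s * t)).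
exact: twisted_term.
Qed.

End Terms.

(** * Splitting the sum over the cut sets *)

Section Sums.
Variables (H : herg) (a : flag H).
Hypothesis ra : rib a != a.
Local Notation e := (ribbon a).
Local Notation K := (contract [set e]).
Let he : e \in edges H. Proof. by rewrite edges_ribbon. Qed.

Lemma big_powerset_setD1 (F : {set {set flag H}} -> {mpoly int[6]}) :
  \sum_(S in powerset (edges H)) F S =
  \sum_(S in powerset (edges H :\ e)) F ([set e] :|: S) +
  \sum_(S in powerset (edges H :\ e)) F S.
Proof.
rewrite (bigID (fun S : {set {set flag H}} => e \in S)) /=; congr (_ + _).
  rewrite (reindex_onto (fun S => [set e] :|: S) (fun S => S :\ e)) /=; last first.
    by move=> S /andP[_ eS]; apply: setD1K.
  apply: eq_bigl => S; rewrite !powersetE subUset sub1set he /= !inE eqxx /= andbT.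
  rewrite subsetD1; congr (_ && _); apply/eqP/idP => [<-|]; first by rewrite !inE eqxx.
  exact: setU1K.
by apply: eq_bigl => S; rewrite !powersetE subsetD1.
Qed.

(** A term depends on the ambient surface only through its rank. Cutting the edge keeps the
    vertices, so this rank drops by the number of components gained: one for a bridge, none
    otherwise. *)
Lemma br_term_cut (S : {set {set flag H}}) :
  let A' := @cut (cut [set e]) S in let A := cut ([set e] :|: S) in
  br_term (cut [set e]) A' * (X_ - 1) ^+ (nb_components (cut [set e]) - nb_components H)
  = br_term H A.
Proof.
move=> A' A; have ct := contraction_cut_cut [set e] S.
have EK : nb_components A' = nb_components A.
  rewrite (nb_components_contraction ct) nb_componentsE.
  congr (#|pred_of_set _| + _)%N; apply: eq_classes; apply: eq_connect => u v.
  by rewrite !step3E /mix inE.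
have EV : nb_vertices A' = nb_vertices A by [].
have EE : #|edges A'| = #|edges A|.
  by rewrite (card_edges_contraction ct) imset0 cards0 addn0.
have Eo : orientable A' = orientable A.
  apply/idP/idP; last exact: orientable_contraction ct.
  case/orientableP=> c [cs ca cr]; apply/orientableP; exists c; split=> // x.
  by have := io_rib ct x; move: (cr x); rewrite /= => + <-.
have En : nullity A' = nullity A by rewrite /nullity EE EK.
rewrite /br_term (nb_closed_faces_contraction ct) (nb_boundary_components_contraction ct).
rewrite (card_hrs_contraction ct) EK En Eo.
have le1 := nb_components_cut [set e]; have le2 := nb_components_le_vertices A.
have := @nb_components_cut (cut [set e]) S; rewrite EK => le3.
have -> : (rank H - rank A = rank (cut [set e]) - rank A' +
    (nb_components (cut [set e]) - nb_components H))%N.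
  by rewrite /rank EK EV -[nb_vertices A]/(nb_vertices H)
    -[nb_vertices (cut [set e])]/(nb_vertices H); move: le2; rewrite -[nb_vertices A]/(nb_vertices H); lia.
by rewrite exprD [LHS]mulrC -!mulrA mulrCA.
Qed.


Definition lift_contract (b : {set flag K}) : {set flag H} :=
  [set of_contract_flag x | x in b].
Local Notation g := lift_contract.

Let g_inj : injective g.
Proof. by apply: imset_inj; apply: val_inj. Qed.

Let g_ribbon (x : flag K) : g (ribbon x) = ribbon (of_contract_flag x).
Proof. by rewrite /g /ribbon !imsetU !imset_set1. Qed.

Lemma edges_contract : edges H :\ e = g @: edges K.
Proof.
apply/setP=> b; apply/setD1P/imsetP => [[be /imsetP[x]]|[b' /imsetP[x]]].
  rewrite inE => rx bE; rewrite bE -mem_ribbon -(contract_flags1 ra) in be.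
  exists (ribbon (Sub x be : flag K)); last by rewrite g_ribbon bE.
  by rewrite edges_ribbon -(inj_eq val_inj).
have DE' y : (y \in e) = (y \in contract_flags [set e]) by rewrite contract_flags1.
rewrite inE => rx -> ->; rewrite g_ribbon -mem_ribbon DE'.
by split; [exact: (valP x) | rewrite edges_ribbon; rewrite -(inj_eq val_inj) in rx].
Qed.

Lemma big_contract (F : {set {set flag H}} -> {mpoly int[6]}) :
  \sum_(S in powerset (edges H :\ e)) F S =
  \sum_(S in powerset (edges K)) F (g @: S).
Proof.
have -> : powerset (edges H :\ e) = [set g @: S | S : {set {set flag K}} in powerset (edges K)].
  apply/setP=> S; rewrite powersetE edges_contract; apply/idP/imsetP => [sS|[S' sS' ->]].
    exists (g @^-1: S); last first.
      apply/setP=> b; apply/idP/imsetP=> [bS|[b' + ->]]; last by rewrite inE.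
      by have /imsetP[b' _ bE] := subsetP sS b bS; exists b'; rewrite // inE -bE.
    by rewrite powersetE; apply/subsetP=> b; rewrite inE => /(subsetP sS); rewrite mem_imset.
  by apply: imsetS; rewrite powersetE in sS'.
by rewrite big_imset //= => S1 S2 _ _; apply: imset_inj.
Qed.

Lemma contract_cut_compat (S : {set {set flag K}}) (x : flag K) :
  (ribbon x \in S) = (ribbon (of_contract_flag x) \in g @: S).
Proof. by rewrite -g_ribbon mem_imset. Qed.

Lemma contract_cut_notin (S : {set {set flag K}}) : S \subset edges K -> e \notin g @: S.
Proof.
move=> sS; have : g @: S \subset edges H :\ e by rewrite edges_contract imsetS.
by rewrite subsetD1 => /andP[].
Qed.

Lemma br_poly_split :
  br_poly H = br_poly (cut [set e]) * (X_ - 1) ^+ (nb_components (cut [set e]) - nb_components H)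
    + \sum_(S in powerset (edges K)) br_term H (cut (g @: S)).
Proof.
rewrite /br_poly big_powerset_setD1; congr (_ + _); last exact: big_contract.
rewrite mulr_suml edges_cut; apply: eq_bigr => S _.
by rewrite br_term_cut.
Qed.

End Sums.

(** * Bridges and the sign of a loop *)

Section Components.
Variables (H : herg) (a : flag H).
Hypothesis ra : rib a != a.

Lemma nb_components_cut1 : nb_components (cut [set ribbon a]) =
  (nb_components H + ~~ connect (@step (flag H) [:: seg; arc; mix (ribbon a) id rib]) a (rib a))%N.
Proof.
rewrite !nb_componentsE addnAC.
have := rectangle_cut_count (@arcK H) (@segK H) (@ribK H) erefl erefl erefl (rib_seg a).
rewrite -/(ribbon a) => <-; congr (#|pred_of_set _| + _)%N.
apply: eq_classes; apply: eq_connect => u v; rewrite !step3E.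
have -> // : @rib (cut [set ribbon a]) u = mix (ribbon a) id rib u.
by rewrite /mix mem_ribbon -in_set1.
Qed.

Lemma bridge_nonloop : bridge (ribbon a) -> ~~ loop (ribbon a) /\
  nb_components (cut [set ribbon a]) = (nb_components H).+1.
Proof.
rewrite /bridge nb_components_cut1.
have [_|nac] := boolP (connect _ a (rib a)); first by rewrite addn0 ltnn.
move=> _; rewrite addn1; split=> //; apply: contra nac; rewrite loopE inE.
apply: (@connect_sub _ (step [:: seg; arc])) => u v; rewrite step2E => uv.
by apply: connect1; rewrite step3E orbA uv.
Qed.

Lemma not_bridge_components : ~~ bridge (ribbon a) ->
  nb_components (cut [set ribbon a]) = nb_components H.
Proof.
rewrite /bridge -leqNgt => le; apply/eqP; rewrite eqn_leq le.
exact: nb_components_cut.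
Qed.

(** Cutting other edges does not change the boundary arcs left by this one, and when it is the only
    edge their pairing alone decides whether the discs can be oriented coherently. *)
Lemma orientable_cut_all : loop (ribbon a) ->
  orientable (cut (edges H :\ ribbon a)) = connect (vertex_off a) a (rib a).
Proof.
move=> lp; set B := cut _.
have aS : ribbon a \notin edges H :\ ribbon a by rewrite !inE eqxx.
have raB : @rib B a != a by rewrite cut_ribE.
have vE := vertex_off_cut aS.
have [ac|nac] := boolP (connect (vertex_off a) a (rib a)).
  apply: (@untwisted_orientable B a) => //; last by rewrite vE cut_ribE.
  move=> x; rewrite ribbon_cut // => xa; apply/eqP; apply: contraNT xa.
  rewrite cut_rib_neq => /andP[xS rx]; rewrite (@mem_ribbon H x a).
  by move: xS; rewrite !inE edges_ribbon rx andbT negbK.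
apply/negbTE/(@twisted_not_orientable B a raB); last by rewrite vE cut_ribE.
by rewrite loop_pairing // vE -loop_pairing.
Qed.

End Components.

Theorem theorem3p11 (H : herg) (e : {set flag H}) (he : e \in edges H) :
  [/\ ordinary e ->
        br_poly H =w br_poly (cut [set e]) + br_poly (contract [set e]),
      bridge e ->
        br_poly H =w (X_ - 1) * br_poly (cut [set e]) + br_poly (contract [set e]),
      trivial_loop e -> negative_loop e ->
        br_poly H =w
          br_poly (cut [set e]) + (Y_ - 1) * Z_ * W_ * br_poly (contract [set e])
    & trivial_loop e -> positive_loop e ->
        br_poly H =w
          br_poly (cut [set e]) + (Y_ - 1) * br_poly (contract [set e])].
Proof.
case/imsetP: he => a; rewrite inE => ra -> {e}.
have notin S := @contract_cut_notin H a ra S.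
have compat S x := @contract_cut_compat H a S x.
(* This serves ordinary edges and bridges alike, since a bridge is not a loop. *)
have nonloop : ~~ loop (ribbon a) ->
    \sum_(S in powerset (edges (contract [set ribbon a])))
      br_term H (cut (@lift_contract H a @: S))
    = br_poly (contract [set ribbon a]).
  rewrite loop_pairing // negbK => ab; apply: eq_bigr => S; rewrite powersetE => sS.
  exact: (br_term_nonloop ra (notin S sS) (compat S) ab).
split.
- case/andP=> nb /nonloop lp; rewrite (br_poly_split ra) not_bridge_components //.
  by rewrite subnn expr0 mulr1 lp; apply: eq_modW_refl.
- move=> br; have [/nonloop lp E] := bridge_nonloop br.
  by rewrite (br_poly_split ra) E subSnn expr1 lp mulrC; apply: eq_modW_refl.
- move=> _ /andP[lp]; rewrite orientable_cut_all // => nac.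
  have nb : ~~ bridge (ribbon a) by apply: contraL lp => /bridge_nonloop[].
  rewrite (br_poly_split ra) not_bridge_components // subnn expr0 mulr1.
  apply: eq_modW_add; first exact: eq_modW_refl.
  (* The congruence is compatible with sums, so it is enough to compare the terms of each cut
     set. *)
  rewrite mulr_sumr; apply: (big_ind2 (fun P Q => P =w Q)); first exact: eq_modW_refl.
    by move=> P P' Q Q'; apply: eq_modW_add.
  move=> S; rewrite powersetE => sS; rewrite loop_pairing // in lp.
  exact: (br_term_twisted ra (notin S sS) (compat S) lp nac).
move=> tr /andP[lp]; rewrite orientable_cut_all // => ac.
have nb : ~~ bridge (ribbon a) by apply: contraL lp => /bridge_nonloop[].
rewrite (br_poly_split ra) not_bridge_components // subnn expr0 mulr1.
rewrite mulr_sumr; rewrite loop_pairing // in lp.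
have sep := trivial_loop_separating ra tr ac.
apply: eq_modW_add; first exact: eq_modW_refl.
apply: (big_ind2 (fun P Q => P =w Q)); first exact: eq_modW_refl.
  by move=> P P' Q Q'; apply: eq_modW_add.
move=> S; rewrite powersetE => sS.
rewrite (br_term_untwisted ra (notin S sS) (compat S) lp ac sep).
exact: eq_modW_refl.
Qed.
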